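(* For primes $p\ge 7$, if $\lambda_1,\lambda_2,\lambda_3$ are chosen uniformly at random from $\mathbb F_{p^2}\smallsetminus\{0,1\}$, then the probability that $C_{\lambda_1,\lambda_2,\lambda_3}\cong C_{\lambda_1,\lambda_2,\lambda_3'}$ for some $\lambda_3'\in\mathbb F_{p^2}$ with $\lambda_3\ne\lambda_3'$ is $O(1/p^2)$.
   Context: For mutually distinct $\lambda,\mu,\nu\in\overline{\mathbb F_p}\smallsetminus\{0,1\}$, $C_{\lambda,\mu,\nu}$ denotes the genus-2 curve in Rosenhain form $y^2=x(x-1)(x-\lambda)(x-\mu)(x-\nu)$; the event in question requires both triples to define genus-2 curves. Isomorphism is over $\overline{\mathbb F_p}$. The $O$-notation is as $p\to\infty$, with an absolute implied constant. *)

(* Defs.v *)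
From HB Require Import structures.
From mathcomp Require Import all_boot all_order all_algebra.
From mathcomp Require Import boolp.
From mathcomp Require Import mpoly.

Set Implicit Arguments.
Unset Strict Implicit.
Unset Printing Implicit Defensive.

Import GRing.Theory.

Local Open Scope ring_scope.

(* The curve y^2 = x(x-1)(x-l)(x-m)(x-n) is used as an abstract complete curve:
   its smooth projective model is the sextic Y^2 = F(X, Z) in the weighted
   projective plane P(1,3,1), with x = X/Z and y = Y/Z^3.  Over an algebraically
   closed field the curve is identified with its set of rational points.
   Weighted homogeneous coordinates (X : Y : Z) are functions 'I_3 -> K. *)

Definition weight (i : 'I_3) : nat := nth 0%N [:: 1; 3; 1]%N i.

Definition wdeg (m : 'X_{1..3}) : nat := (\sum_(i < 3) weight i * m i)%N.

Lemma wdeg0 : wdeg 0%MM = 0%N.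
Proof. by rewrite /wdeg big1 // => i _; rewrite mnm0E muln0. Qed.

Lemma wdegD : {morph wdeg : m1 m2 / (m1 + m2)%MM >-> (m1 + m2)%N}.
Proof.
move=> m1 m2; rewrite /wdeg -big_split /=.
by apply: eq_bigr => i _; rewrite mnmDE mulnDr.
Qed.

HB.instance Definition _ := isMeasure.Build 3 wdeg wdeg0 wdegD.

Section Curves.
Variable K : fieldType.

Implicit Types (P Q : 'I_3 -> K) (C D : ('I_3 -> K) -> Prop).

Definition nonzero P : Prop := exists i, P i != 0.

Definition same_point P Q : Prop :=
  exists2 t : K, t != 0 & forall i, Q i = t ^+ weight i * P i.

Definition rosenhain_curve (l m n : K) P : Prop :=
  let X := P 0 in let Y := P 1 in let Z := P 2 in
  nonzero P /\
  Y ^+ 2 = Z * X * (X - Z) * (X - l * Z) * (X - m * Z) * (X - n * Z).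

Definition rosenhain_genus2 (l m n : K) : bool := uniq [:: 0; 1; l; m; n].

(* A morphism is a map on points which near every point P is given by
   polynomials A_0, A_1, A_2 weighted homogeneous of degrees d, 3d, d for some d.
   The open neighbourhood of P is the locus where the A_i do not all vanish:
   since the curves are irreducible and separated, agreement near P forces
   agreement wherever the A_i define a point. *)
Definition regular_at C (phi : ('I_3 -> K) -> 'I_3 -> K) P : Prop :=
  exists (d : nat) (A : 'I_3 -> {mpoly K[3]}),
    [/\ forall i, A i \is (weight i * d)%N.-homog for wdeg,
        nonzero (fun i => (A i).@[P])
      & forall Q, C Q -> nonzero (fun i => (A i).@[Q]) ->
          same_point (phi Q) (fun i => (A i).@[Q])].

Definition curve_morphism C D (phi : ('I_3 -> K) -> 'I_3 -> K) : Prop :=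
  [/\ forall P, C P -> D (phi P),
      forall P Q, C P -> C Q -> same_point P Q -> same_point (phi P) (phi Q)
    & forall P, C P -> regular_at C phi P].

Definition curve_isomorphic C D : Prop :=
  exists phi psi : ('I_3 -> K) -> 'I_3 -> K,
    [/\ curve_morphism C D phi, curve_morphism D C psi,
        forall P, C P -> same_point (psi (phi P)) P
      & forall Q, D Q -> same_point (phi (psi Q)) Q].

End Curves.

Definition uniform_prob (T : finType) (A : {set T}) (E : T -> Prop) : rat :=
  #|[set t in A | `[< E t >]]|%:R / #|A|%:R.

Definition not01 (F : finFieldType) : {set F} := ~: [set 0; 1].

Definition not01_triples (F : finFieldType) : {set F * F * F} :=
  setX (setX (not01 F) (not01 F)) (not01 F).

(* Isomorphism is tested over K, which contains F through iota. *)
Definition has_isomorphic_neighbour (F : finFieldType) (K : fieldType)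
    (iota : {rmorphism F -> K}) (t : F * F * F) : Prop :=
  let: (l1, l2, l3) := t in
  exists l3' : F,
    [/\ l3 != l3', rosenhain_genus2 l1 l2 l3, rosenhain_genus2 l1 l2 l3'
      & curve_isomorphic
          (rosenhain_curve (iota l1) (iota l2) (iota l3))
          (rosenhain_curve (iota l1) (iota l2) (iota l3'))].

(* Main.v *)
Require Import Defs.
From HB Require Import structures.
From mathcomp Require Import all_boot all_order all_algebra.
From mathcomp Require Import polyXY finfield ring zify.
From mathcomp Require Import mpoly.

Set Implicit Arguments.
Unset Strict Implicit.
Unset Printing Implicit Defensive.

Import Order.TTheory GRing.Theory Num.Theory.

Local Open Scope ring_scope.

(** Why the theorem is true. A curve of genus 2 carries exactly one map of
degree 2 to the projective line up to Moebius transformations, so an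
isomorphism between the curves of parameters (l, m, n) and (l, m, n') induces
a Moebius transformation M carrying the six branch points oo, 0, 1, l, m, n to
the six branch points oo, 0, 1, l, m, n' ([isomorphism_bilin]). Five of the six
points are shared. If n <> n', the permutation of indices given by M forces M
to carry some four of the shared points to four shared points in an order
which does not come from the Klein four-group ([permutation_trichotomy],
[isomorphic_neighbour_special]): otherwise M would fix three points and be the
identity, or swap two points and be an involution, and both lead to n = n'.
Since M preserves cross-ratios, (l, m) then lies on one of finitely many plane
curves, each given by a polynomial of bounded degree which is nonzero outside
characteristic 2 ([quadruple_gap_neq0]). Hence O(q) of the q^2 pairs (l, m) are
possible ([card_special_pairs]), which is a proportion O(1/q) with q = p^2.

The uniqueness of the degree 2 map is proved by elementary algebra. Let phi be
the isomorphism, psi its inverse, y^2 = f(x) the source, and u the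
x-coordinate of phi(x, y). Write u = (a + b y) / N with polynomials a, b, N
in x. If b <> 0, then u is a root of a primitive quadratic R(x, t) which is
irreducible over K(x). Applied to psi, the same expression makes x a root of a
quadratic S(x, u), so that R divides S by the Gauss lemma and R has degree at
most 2 in x ([degree_transfer]). Its discriminant then has degree at most 4,
whereas up to squares it equals f, which is squarefree of degree 5: a
contradiction. So u is a rational function of x ([x_image_even]); comparing
degrees once more, now for R and S linear in t and in x, shows that u = M(x)
with M a Moebius transformation ([x_image_moebius]).

For the branch points, let w^2 = H(x) be the equation of the target pulled back
by M, with H of degree at most 6. Cleared of a denominator in x, the function w
has the form p + q y; since w^2 is a function of x alone, p = 0 or q = 0. The
case q = 0 would identify (x, y) with (x, -y), so f and H agree up to squares:
the roots of f are roots of H, and the degree of H is odd, which says that oo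
goes to a branch point too ([isomorphism_branch_divisor]). *)

(** * Polynomials over an algebraically closed field *)

Section PolyClosed.
Variable K : closedFieldType.
Implicit Types (e p q A B H : {poly K}).

Lemma poly_identity0 p : (forall x, p.[x] = 0) -> p = 0.
Proof.
move=> p0; apply/eqP/negPn/negP => nz_p.
have [p1 | np1] := boolP (size (p - 1)%R == 1%N).
  have /size_poly1P[c nz_c Ec] := p1.
  move: (p0 0); rewrite -[p](subrK 1) Ec hornerD !hornerE => h.
  by move: nz_p; rewrite -[p](subrK 1) Ec -polyCD h eqxx.
have /closed_rootP[x] := np1.
by rewrite /root !hornerE p0 sub0r oppr_eq0 oner_eq0.
Qed.

Lemma poly_generic0 e p :
  e != 0 -> (forall x, e.[x] != 0 -> p.[x] = 0) -> p = 0.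
Proof.
move=> nz_e p0; have /eqP: e * p = 0.
  apply: poly_identity0 => x; rewrite hornerM.
  by have [-> | /p0 ->] := eqVneq e.[x] 0; rewrite (mul0r, mulr0).
by rewrite mulf_eq0 (negPf nz_e) => /eqP.
Qed.

Lemma exists_nonroot e : e != 0 -> exists x, e.[x] != 0.
Proof.
move=> nz_e; have [[x ex]|h] := boolp.pselect (exists x, e.[x] != 0).
  by exists x.
case/eqP: nz_e; apply: poly_identity0 => x; apply/eqP/negPn/negP => ex.
by apply: h; exists x.
Qed.
End PolyClosed.

(** In A^2 f = B^2 H every root of f occurs to an odd order on the left, hence
also in H. *)
Lemma squarefree_dvd_odd_part (F : fieldType) (rs : seq F) (A B H : {poly F}) :
  uniq rs -> B != 0 ->
  A ^+ 2 * \prod_(z <- rs) ('X - z%:P) = B ^+ 2 * H ->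
  \prod_(z <- rs) ('X - z%:P) %| H.
Proof.
set f := \prod_(z <- rs) _ => urs nzB E.
have nzf : f != 0 by rewrite monic_neq0 // monic_prod_XsubC.
have [A0|nzA] := eqVneq A 0.
  move/esym/eqP: E; rewrite A0 expr0n mul0r mulf_eq0 expf_eq0 (negPf nzB) andbF.
  by move=> /eqP ->; rewrite dvdp0.
apply: uniq_roots_dvdp; last by rewrite uniq_rootsE.
apply/allP => z zrs; apply/negPn/negP => /mupNroot Hz.
have nzH : H != 0.
  apply/eqP => H0; move/eqP: E; rewrite H0 mulr0 mulf_eq0 (negPf nzf) orbF.
  by rewrite expf_eq0 (negPf nzA) andbF.
move/(congr1 (mup z)): E; rewrite !mupM ?expf_neq0 // Hz mu_prod_XsubC.
by rewrite count_uniq_mem // zrs => /(congr1 odd); rewrite !oddD /= !addbb.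
Qed.

Section DegreeTransfer.
Variable K : closedFieldType.
Implicit Types (e g : {poly K}) (r s q R S : {poly {poly K}}).

(** Elements of {poly {poly K}} are polynomials in x whose coefficients are
polynomials in t. Over an algebraically closed field, being primitive as a
polynomial in t amounts to having no factor x - x0, which is what evaluation at
x0 tests. *)
Definition primitiveXY r := forall x : K, r.[x%:P] != 0.

Lemma XsubC_polyC (x : K) : ('X - x%:P) ^:P = 'X - (x%:P)%:P.
Proof. by rewrite rmorphB /= map_polyX map_polyC. Qed.

Lemma primitive_part r :
  r != 0 -> exists g r0, [/\ g != 0, r = g ^:P * r0 & primitiveXY r0].
Proof.
elim: {r}(size r) {-2}r (leqnn (size r)) => [|n IHn] r.
  by rewrite leqn0 size_poly_eq0 => /eqP ->; rewrite eqxx.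
move=> szr nzr.
have [prim|nprim] := boolp.pselect (primitiveXY r).
  by exists 1, r; rewrite oner_neq0 rmorph1 mul1r.
have [x rx] : exists x : K, r.[x%:P] = 0.
  apply: boolp.contrapT => h; apply: nprim => x; apply/eqP => rx.
  by apply: h; exists x.
have /factor_theorem[r1 Er1] : root r x%:P by apply/eqP.
have nzr1 : r1 != 0 by apply: contra_neq nzr => r10; rewrite Er1 r10 mul0r.
have szr1 : (size r1 <= n)%N.
  by move: szr; rewrite Er1 size_mul ?polyXsubC_eq0 // size_XsubC addn2.
have [g [r0 [nzg Er0 prim]]] := IHn _ szr1 nzr1.
exists (g * ('X - x%:P)), r0; split=> //.
  by rewrite mulf_neq0 // polyXsubC_eq0.
by rewrite Er1 Er0 rmorphM /= XsubC_polyC mulrAC.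
Qed.

(** Here the outer variable is t, so that the content g is a plain constant
factor; this is the form in which concrete quadratics in t are written. *)
Lemma primitive_part_swap R :
    R != 0 -> exists g R0, [/\ g != 0, R = g%:P * R0, size R = size R0
                             & primitiveXY (swapXY R0)].
Proof.
move=> nzR; have [|g [r [nzg ER prim]]] := @primitive_part (swapXY R).
  by rewrite swapXY_eq0.
have {}ER : R = g%:P * swapXY r.
  by rewrite -[R]swapXYK ER rmorphM /= swapXY_map_polyC.
exists g, (swapXY r); split=> //; last by rewrite swapXYK.
by rewrite ER mul_polyC size_scale.
Qed.

(** Roots of e can be cancelled one at a time: at a root x0 the product q r
vanishes, and r does not. *)
Lemma gauss_primitive e r s q :
  e != 0 -> primitiveXY r -> e ^:P * s = q * r -> exists q0, s = q0 * r.
Proof.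
move=> nze prim; elim: {e}(size e) {-2}e (leqnn (size e)) nze q => [|n IHn] e.
  by rewrite leqn0 size_poly_eq0 => /eqP ->; rewrite eqxx.
move=> sze nze q E.
have [/size_poly1P[c nzc Ec]|ne1] := boolP (size e == 1%N).
  exists ((c^-1)%:P%:P * q); rewrite -mulrA -E mulrA Ec map_polyC -rmorphM /=.
  by rewrite -polyCM mulVf // mul1r.
have /closed_rootP[x ex] := ne1.
have /eqP : q.[x%:P] * r.[x%:P] = 0.
  by rewrite -hornerM -E hornerM horner_map /= (rootP ex) mul0r.
rewrite mulf_eq0 (negPf (prim x)) orbF => /factor_theorem[q1 Eq1].
have /factor_theorem[e1 Ee1] := ex.
have nze1 : e1 != 0 by apply: contra_neq nze => h; rewrite Ee1 h mul0r.
apply: (IHn e1 _ nze1 q1).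
  by move: sze; rewrite Ee1 size_mul ?polyXsubC_eq0 // size_XsubC addn2.
apply: (@mulIf _ ('X - (x%:P)%:P)); first by rewrite polyXsubC_eq0.
by rewrite -[RHS]mulrAC -Eq1 -E Ee1 rmorphM /= XsubC_polyC mulrAC.
Qed.

(** R and S have outer variable t. If for almost all x the polynomial R(x, t)
has as many distinct roots as its degree in t allows, and they are roots of
S(x, t), then R divides S over K(x), hence over K[x] when R is primitive, and
the degree of R in x is at most that of S. This replaces counting zeros and
poles with multiplicities on the curve. *)
Lemma degree_transfer e R S :
    e != 0 -> S != 0 -> primitiveXY (swapXY R) ->
    (forall x, e.[x] != 0 -> exists rs : seq K,
       [/\ uniq rs, (size R <= (size rs).+1)%N
         & forall t, t \in rs -> R.[t, x] = 0 /\ S.[t, x] = 0]) ->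
  (size (swapXY R) <= size (swapXY S))%N.
Proof.
move=> nze nzS prim roots.
have nzR : R != 0.
  by rewrite -swapXY_eq0; apply: contraNneq (prim 0) => ->; rewrite horner0.
(* The remainder of the pseudo-division in t has too many roots. *)
have E := Pdiv.Idomain.divp_eq S R.
set k := scalp S R in E; set Q := S %/ R in E; set T := S %% R in E.
have T0 : T = 0.
  apply/eqP; rewrite -swapXY_eq0; apply/eqP.
  suff h x : e.[x] != 0 -> (swapXY T).[x%:P] = 0.
    apply/polyP => i; rewrite coef0; apply/polyP => j; rewrite coef0.
    rewrite coef_swapXY.
    suff -> : T`_j = 0 by rewrite coef0.
    apply: (poly_generic0 nze) => x ex.
    have := congr1 (fun p : {poly K} => p`_j) (h x ex).
    by rewrite horner_swapXY coef0 coef_map.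
  move=> ex; have [rs [urs szR rsP]] := roots x ex.
  apply/eqP/negPn/negP => nzT.
  have : (size rs < size (swapXY T).[x%:P])%N.
    apply: max_poly_roots => //.
    apply/allP => t /rsP[Rt St]; rewrite /root horner2_swapXY.
    have := congr1 (fun P => P.[t, x]) E.
    by rewrite hornerZ hornerM St mulr0 hornerD !hornerE Rt mulr0 add0r => <-.
  rewrite horner_swapXY => /leq_trans/(_ (size_poly _ _)) szT.
  have szTR : (size T < size R)%N by rewrite /T Pdiv.Idomain.ltn_modp.
  by move: (leq_trans szTR szR); rewrite ltnS leqNgt szT.
rewrite T0 addr0 in E.
have nzl : lead_coef R ^+ k != 0 by rewrite expf_neq0 // lead_coef_eq0.
have E' : (lead_coef R ^+ k) ^:P * swapXY S = swapXY Q * swapXY R.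
  by rewrite -swapXY_polyC -!rmorphM /= mul_polyC E.
have [q0 Eq0] := gauss_primitive nzl prim E'.
have nzs : swapXY S != 0 by rewrite swapXY_eq0.
have nzq : q0 != 0 by apply: contra_neq nzs => h; rewrite Eq0 h mul0r.
have nzr : swapXY R != 0 by rewrite swapXY_eq0.
by rewrite Eq0 size_mul // -(prednK (_ : 0 < size q0)%N) ?size_poly_gt0 // leq_addl.
Qed.
End DegreeTransfer.

(** * Points of the curves *)
Lemma ord3P (i : 'I_3) : [\/ i = 0, i = 1 | i = 2].
Proof.
case: i => [[|[|[|//]]] lti]; [apply: Or31|apply: Or32|apply: Or33]; exact: val_inj.
Qed.

Section SamePoint.
Variable K : fieldType.
Implicit Types P Q : 'I_3 -> K.

Lemma same_pointE P Q :
  same_point P Q <->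
  exists2 t : K, t != 0 & [/\ Q 0 = t * P 0, Q 1 = t ^+ 3 * P 1 & Q 2 = t * P 2].
Proof.
split=> [[t nzt h]|[t nzt [h0 h1 h2]]]; exists t => //.
by move=> i; case: (ord3P i) => ->; rewrite ?h0 ?h1 ?h2 /weight /= ?expr1.
Qed.

Lemma same_point_sym P Q : same_point P Q -> same_point Q P.
Proof.
move=> [t nzt h]; exists t^-1; first by rewrite invr_eq0.
by move=> i; rewrite h mulrA -exprMn mulVf // expr1n mul1r.
Qed.

Lemma same_point_trans P Q R : same_point P Q -> same_point Q R -> same_point P R.
Proof.
move=> [t nzt h] [s nzs k]; exists (s * t); first by rewrite mulf_neq0.
by move=> i; rewrite k h mulrA exprMn.
Qed.

Definition affine_point (x y : K) : 'I_3 -> K := fun i => nth 0 [:: x; y; 1] i.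

Lemma affine_representative P : P 2 != 0 ->
  same_point P (affine_point (P 0 / P 2) (P 1 / P 2 ^+ 3)).
Proof.
move=> nzP2; apply/same_pointE; exists (P 2)^-1; first by rewrite invr_eq0.
by rewrite /affine_point /= exprVn mulVf // ![_^-1 * _]mulrC.
Qed.

Lemma same_affine_point x y x' y' :
  same_point (affine_point x y) (affine_point x' y') -> x = x' /\ y = y'.
Proof.
case/same_pointE => t _ []; rewrite /affine_point /= => -> -> /esym.
by rewrite mulr1 => ->; rewrite expr1n !mul1r.
Qed.

Lemma nonzeroE P : nonzero P <-> [\/ P 0 != 0, P 1 != 0 | P 2 != 0].
Proof.
split=> [[i]|[]h]; [|by exists 0|by exists 1|by exists 2].
by case: (ord3P i) => ->; [apply: Or31|apply: Or32|apply: Or33].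
Qed.

End SamePoint.

Section RosenhainPoints.
Variables (K : fieldType) (l m n : K).
Implicit Types P Q : 'I_3 -> K.
Notation C := (rosenhain_curve l m n).

Definition branch_poly : {poly K} :=
  \prod_(z <- [:: 0; 1; l; m; n]) ('X - z%:P).

Lemma horner_branch_poly x :
  branch_poly.[x] = x * (x - 1) * (x - l) * (x - m) * (x - n).
Proof.
rewrite /branch_poly !big_cons big_nil !hornerM !hornerXsubC hornerC.
by ring.
Qed.

Lemma branch_poly_neq0 : branch_poly != 0.
Proof. by rewrite monic_neq0 // monic_prod_XsubC. Qed.

Lemma size_branch_poly : size branch_poly = 6%N.
Proof. by rewrite size_prod_XsubC. Qed.

Definition sextic_form (U W : K) :=
  W * U * (U - W) * (U - l * W) * (U - m * W) * (U - n * W).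

Lemma sextic_formZ s U W : sextic_form (s * U) (s * W) = s ^+ 6 * sextic_form U W.
Proof. by rewrite /sextic_form; ring. Qed.

Lemma rosenhain_affine x y : C (affine_point x y) <-> y ^+ 2 = branch_poly.[x].
Proof.
rewrite /rosenhain_curve /affine_point /= horner_branch_poly !mulr1 mul1r.
by split=> [[]//|h]; split=> //; apply/nonzeroE/Or33; rewrite oner_neq0.
Qed.

Lemma rosenhain_XZ P : C P -> P 0 = 0 -> P 2 = 0 -> False.
Proof.
move=> [/nonzeroE nz /eqP E] P0 P2; move: E nz.
rewrite /= P0 P2 !mul0r expf_eq0 /= => /eqP P1.
by rewrite P1 !eqxx => -[].
Qed.

(** The fibres of the projection to the (X : Z)-line are the orbits of the
hyperelliptic involution. *)
Lemma proportional_points P Q :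
    C P -> C Q -> P 0 * Q 2 = P 2 * Q 0 ->
  exists2 s : K, s != 0 &
    [/\ Q 0 = s * P 0, Q 2 = s * P 2
      & Q 1 = s ^+ 3 * P 1 \/ Q 1 = - (s ^+ 3 * P 1)].
Proof.
move=> CP CQ E.
have [s nzs [E0 E2]] : exists2 s : K, s != 0 & Q 0 = s * P 0 /\ Q 2 = s * P 2.
  have [P2|nzP2] := eqVneq (P 2) 0.
    have nzP0 : P 0 != 0 by apply/eqP => P0; apply: rosenhain_XZ CP P0 P2.
    have Q2 : Q 2 = 0.
      by move/eqP: E; rewrite P2 mul0r mulf_eq0 (negPf nzP0) => /eqP.
    exists (Q 0 / P 0); last by rewrite P2 Q2 mulr0 divfK.
    rewrite mulf_neq0 ?invr_eq0 //.
    by apply/eqP => Q0; apply: rosenhain_XZ CQ Q0 Q2.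
  have E0 : Q 0 = Q 2 / P 2 * P 0 by rewrite mulrAC -[Q 2 * _]mulrC E mulrC mulKf.
  exists (Q 2 / P 2); last by rewrite divfK.
  rewrite mulf_neq0 ?invr_eq0 //; apply/eqP => Q2.
  by apply: (rosenhain_XZ CQ _ Q2); rewrite E0 Q2 !mul0r.
exists s => //; split=> //; move: CP CQ => -[_ /= EP] [_ /=].
rewrite E0 E2 -[X in _ = X]/(sextic_form (s * P 0) (s * P 2)) sextic_formZ.
rewrite /sextic_form -EP (_ : 6 = 3 * 2)%N // exprM -exprMn => /eqP.
by rewrite eqf_sqr => /orP[]/eqP; [left|right].
Qed.

Lemma same_point_curve P Q : same_point P Q -> C P -> C Q.
Proof.
move=> PQ; case/same_pointE: (PQ) => t nzt [E0 E1 E2] [[i nzi] E]; split.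
  case: PQ => s nzs h; exists i; by rewrite h mulf_neq0 // expf_neq0.
rewrite /= E0 E1 E2 -[RHS]/(sextic_form (t * P 0) (t * P 2)) sextic_formZ.
by rewrite exprMn -exprM E.
Qed.

End RosenhainPoints.

(** * Regular functions on the affine curve *)
Section Regular.
Variables (K : closedFieldType) (f : {poly K}).
Implicit Types (g h : K -> K -> K) (a b e N : {poly K}).

Definition on_curve (x y : K) := y ^+ 2 = f.[x].

(** Since y^2 = f(x) on the curve, every polynomial function has this normal
form. Functions are kept as functions of (x, y), and only their values on the
curve matter. *)
Definition regular g :=
  exists a b, forall x y, on_curve x y -> g x y = a.[x] + b.[x] * y.

Lemma on_curveN x y : on_curve x y -> on_curve x (- y).
Proof. by rewrite /on_curve sqrrN. Qed.

Lemma on_curve_exists x : exists y, on_curve x y.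
Proof.
have : size ('X^2 - (f.[x])%:P) != 1%N by rewrite size_XnsubC.
move/closed_rootP => [y]; rewrite /root !hornerE subr_eq0 => /eqP h.
by exists y; rewrite /on_curve -h ?hornerXn.
Qed.

Lemma regular_poly a : regular (fun x _ => a.[x]).
Proof. by exists a, 0 => x y _; rewrite horner0 mul0r addr0. Qed.

Lemma regularM g h : regular g -> regular h -> regular (fun x y => g x y * h x y).
Proof.
move=> [a [b Eg]] [c [d Eh]].
exists (a * c + b * d * f), (a * d + b * c) => x y Cxy.
by rewrite Eg // Eh // !hornerD !hornerM -Cxy; ring.
Qed.

Lemma regularX g k : regular g -> regular (fun x y => g x y ^+ k).
Proof.
move=> rg; elim: k => [|k IHk].
  have [a [b E]] := regular_poly 1; exists a, b => x y Cxy.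
  by rewrite expr0 -E // hornerC.
have [a [b E]] := regularM rg IHk; exists a, b => x y Cxy.
by rewrite exprS E.
Qed.

Lemma regular_conj g : regular g -> regular (fun x y => g x (- y)).
Proof.
move=> [a [b E]]; exists a, (- b) => x y Cxy.
by rewrite E ?hornerN ?mulrN ?mulNr //; exact: on_curveN.
Qed.

Lemma regular_mpoly (A : {mpoly K[3]}) : regular (fun x y => A.@[affine_point x y]).
Proof.
elim/mpolyind: A => [|c m p _ _ [a [b E]]].
  by exists 0, 0 => x y _; rewrite meval0 horner0 mul0r addr0.
have [a' [b' E']] :
    regular (fun x y => ('X_[m] : {mpoly K[3]}).@[affine_point x y]).
  pose Y k : K -> K -> K := fun _ y => y ^+ k.
  have rY k : regular (Y k).
    apply: (@regularX (fun _ y => y)); exists 0, 1 => x y _.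
    by rewrite horner0 hornerC add0r mul1r.
  have [a' [b' E']] := regularM (regular_poly 'X^(m 0)) (rY (m 1)).
  exists a', b' => x y Cxy.
  rewrite -E' // mevalX !big_ord_recl big_ord0.
  rewrite /affine_point /= expr1n !mulr1 hornerXn /Y.
  by congr (_ ^+ m _ * _ ^+ m _); apply: val_inj.
exists (c *: a' + a), (c *: b' + b) => x y Cxy.
by rewrite mevalD mevalZ E // E' // !hornerD !hornerZ; ring.
Qed.

Hypotheses (nz2 : 2 != 0 :> K) (nzf : f != 0).

(** The normal form is unique, even when tested at almost all points: compare
(x, y) with (x, -y). *)
Lemma regular_eq0 e a b :
    e != 0 ->
    (forall x y, on_curve x y -> e.[x] != 0 -> a.[x] + b.[x] * y = 0) ->
  a = 0 /\ b = 0.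
Proof.
move=> nze h.
have ab x y : on_curve x y -> e.[x] != 0 -> a.[x] = 0 /\ b.[x] * y = 0.
  move=> Cxy ex; have hp := h x y Cxy ex; have hm := h x _ (on_curveN Cxy) ex.
  have a0 : a.[x] = 0.
    apply: (mulfI nz2); rewrite mulr0.
    transitivity ((a.[x] + b.[x] * y) + (a.[x] + b.[x] * - y)); first by ring.
    by rewrite hp hm addr0.
  by split=> //; move: hp; rewrite a0 add0r.
split.
  apply: (poly_generic0 nze) => x ex.
  by have [y Cxy] := on_curve_exists x; case: (ab x y).
apply: (@poly_generic0 _ (e * f)); first by rewrite mulf_neq0.
move=> x; rewrite hornerM mulf_eq0 negb_or => /andP[ex fx].
have [y Cxy] := on_curve_exists x; have [_ /eqP] := ab x y Cxy ex.
rewrite mulf_eq0 => /orP[/eqP//|/eqP y0].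
by move: fx; rewrite -Cxy y0 expr0n eqxx.
Qed.

End Regular.

(** The norm a^2 - b^2 f of a + b y vanishes only if a = b = 0, because f is not
a square in K(x). *)
Lemma regular_norm (K : closedFieldType) (rs : seq K) (g : K -> K -> K) :
    let f := \prod_(z <- rs) ('X - z%:P) in
    uniq rs -> rs != [::] -> regular f g ->
    (exists x y, on_curve f x y /\ g x y != 0) ->
  exists2 N : {poly K}, N != 0 &
    forall x y, on_curve f x y -> N.[x] = g x y * g x (- y).
Proof.
move=> f urs nzrs [a [b E]] [x0 [y0 [C0 nz0]]].
exists (a ^+ 2 - b ^+ 2 * f); last first.
  move=> x y Cxy; rewrite E // E; last exact: on_curveN.
  by rewrite hornerD hornerN [(_ * f).[x]]hornerM !horner_exp -Cxy; ring.
apply/eqP => /subr0_eq Eab.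
have a0 : a = 0.
  apply/eqP/negPn/negP => nza.
  have := squarefree_dvd_odd_part urs nza (H := 1).
  rewrite mulr1 Eab => /(_ b erefl).
  move/dvdp_leq => /(_ (oner_neq0 _)); rewrite size_prod_XsubC size_poly1.
  by case: (rs) nzrs.
have b0 : b = 0.
  have nzf : f != 0 by rewrite monic_neq0 // monic_prod_XsubC.
  move/esym/eqP: Eab; rewrite a0 expr0n mulf_eq0 (negPf nzf) orbF.
  by rewrite expf_eq0 => /eqP.
by move: nz0; rewrite E // a0 b0 !horner0 mul0r addr0 eqxx.
Qed.

(** * The coordinate x under an isomorphism *)
Section Isomorphism.
Variable K : closedFieldType.
Implicit Types (a b e N : {poly K}) (phi psi : ('I_3 -> K) -> 'I_3 -> K).

Definition mutually_inverse (C D : ('I_3 -> K) -> Prop) phi psi :=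
  [/\ curve_morphism C D phi, curve_morphism D C psi,
      forall P, C P -> same_point (psi (phi P)) P
    & forall Q, D Q -> same_point (phi (psi Q)) Q].

Lemma mutually_inverse_sym C D phi psi :
  mutually_inverse C D phi psi -> mutually_inverse D C psi phi.
Proof. by case. Qed.

(** A0, A1, A2 give phi in weighted coordinates; t = 0 is allowed, at the points
where all three vanish. *)
Definition chart (f : {poly K}) phi (A0 A1 A2 : K -> K -> K) :=
  [/\ regular f A0, regular f A1, regular f A2
    & forall x y, on_curve f x y -> let Q := phi (affine_point x y) in
      exists t, [/\ A0 x y = t * Q 0, A1 x y = t ^+ 3 * Q 1 & A2 x y = t * Q 2]].

(** The polynomials that define a morphism near one point define it at every
affine point where they do not all vanish. *)
Lemma morphism_chart (l m n : K) D phi :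
    let f := branch_poly l m n in
    curve_morphism (rosenhain_curve l m n) D phi ->
  exists A0 A1 A2, chart f phi A0 A1 A2 /\
    exists x y, on_curve f x y /\ [\/ A0 x y != 0, A1 x y != 0 | A2 x y != 0].
Proof.
move=> f [_ _ reg].
have [y0 C0] := on_curve_exists f 0.
have /reg[d [A [_ nzA EA]]] : rosenhain_curve l m n (affine_point 0 y0).
  exact/rosenhain_affine.
pose ev i x y := (A i).@[affine_point x y].
exists (ev 0), (ev 1), (ev 2); split; last first.
  by exists 0, y0; split=> //; apply/(nonzeroE (fun i => ev i 0 y0)).
split; try exact: regular_mpoly.
move=> x y Cxy Q; have CP : rosenhain_curve l m n (affine_point x y).
  exact/rosenhain_affine.
have [/(EA _ CP)/same_pointE[t _ [E0 E1 E2]]|h] :=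
  boolp.pselect (nonzero (fun i => (A i).@[affine_point x y])); first by exists t.
have z i : ev i x y = 0 by apply/eqP/negPn/negP => nz; apply: h; exists i.
by exists 0; rewrite !z expr0n !mul0r.
Qed.

Section Pair.
Variables (l m n l' m' n' : K) (phi psi : ('I_3 -> K) -> 'I_3 -> K).
Let f := branch_poly l m n.
Let C := rosenhain_curve l m n.
Let D := rosenhain_curve l' m' n'.
Hypothesis gC : rosenhain_genus2 l m n.
Hypothesis iso : mutually_inverse C D phi psi.
Notation phia x y := (phi (affine_point x y)).

Lemma isomorphism_maps x y : on_curve f x y -> D (phia x y).
Proof. by case: iso => -[h _ _] _ _ _ /rosenhain_affine/h. Qed.

Lemma isomorphism_inj x y x' y' :
    on_curve f x y -> on_curve f x' y' -> same_point (phia x y) (phia x' y') ->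
  x = x' /\ y = y'.
Proof.
case: iso => -[hphi _ _] [_ hpsi _] psiK _.
move=> /rosenhain_affine CP /rosenhain_affine CQ PQ.
apply: same_affine_point; apply: same_point_trans (psiK _ CQ).
apply: same_point_trans (same_point_sym (psiK _ CP)) _.
by apply: hpsi PQ; apply: hphi.
Qed.

(** At most two points have a given image on the (X : Z)-line, so phi, being
injective, cannot send the points above three values of x to the same one. *)
Lemma x_image_nonconstant e U W :
    e != 0 -> U != 0 \/ W != 0 ->
    (forall x y, on_curve f x y -> e.[x] != 0 ->
       phia x y 0 * W = phia x y 2 * U) ->
  False.
Proof.
move=> nze nzUW h.
have [x1 ex1] := exists_nonroot nze.
have [x2] : exists x, (e * ('X - x1%:P)).[x] != 0.
  by apply: exists_nonroot; rewrite mulf_neq0 // polyXsubC_eq0.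
rewrite hornerM mulf_eq0 negb_or hornerXsubC subr_eq0 => /andP[ex2 x21].
have [x3] : exists x, (e * ('X - x1%:P) * ('X - x2%:P)).[x] != 0.
  by apply: exists_nonroot; rewrite !mulf_neq0 // polyXsubC_eq0.
rewrite !hornerM !mulf_eq0 !negb_or !hornerXsubC !subr_eq0.
move=> /andP[/andP[ex3 x31] x32].
have [y1 C1] := on_curve_exists f x1.
have [y2 C2] := on_curve_exists f x2.
have [y3 C3] := on_curve_exists f x3.
have prop x y x' y' : on_curve f x y -> on_curve f x' y' ->
    e.[x] != 0 -> e.[x'] != 0 ->
    phia x y 0 * phia x' y' 2 = phia x y 2 * phia x' y' 0.
  move=> Cx Cx' /(h _ _ Cx) E /(h _ _ Cx') E'.
  case: nzUW => nz; apply: (mulIf nz).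
    transitivity (phia x y 0 * W * phia x' y' 0); last by rewrite E; ring.
    transitivity (phia x y 0 * (phia x' y' 2 * U)); first by ring.
    by rewrite -E'; ring.
  transitivity (phia x y 2 * (phia x' y' 2 * U)); last by rewrite -E'; ring.
  by rewrite mulrAC E; ring.
have step x y x' y' : on_curve f x y -> on_curve f x' y' ->
    e.[x] != 0 -> e.[x'] != 0 -> x' != x ->
  exists2 s : K, s != 0 &
    [/\ phia x' y' 0 = s * phia x y 0, phia x' y' 2 = s * phia x y 2
      & phia x' y' 1 = - (s ^+ 3 * phia x y 1)].
  move=> Cx Cx' ex ex' nxx.
  have [s nzs [E0 E2 [E1|E1]]] := proportional_points (isomorphism_maps Cx)
    (isomorphism_maps Cx') (prop _ _ _ _ Cx Cx' ex ex'); last by exists s.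
  case/eqP: nxx; have [] // := isomorphism_inj Cx Cx'.
  by apply/same_pointE; exists s.
have [s nzs [s0 s2 s1]] := step _ _ _ _ C1 C2 ex1 ex2 x21.
have [t nzt [t0 t2 t1]] := step _ _ _ _ C1 C3 ex1 ex3 x31.
have [] : x2 = x3 /\ y2 = y3; last by move=> E; rewrite E eqxx in x32.
apply: isomorphism_inj => //; apply/same_pointE; exists (t / s).
  by rewrite mulf_neq0 ?invr_eq0.
rewrite s0 s1 s2 t0 t1 t2 exprMn exprVn; split; first by rewrite mulrA divfK.
  by rewrite mulrN mulrA divfK // expf_neq0.
by rewrite mulrA divfK.
Qed.

(** The coordinate A2 is not identically zero: otherwise almost all affine
points would go to the single point at infinity. *)
Lemma isomorphism_chart :
  exists A0 A1 A2 N, [/\ chart f phi A0 A1 A2, N != 0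
    & forall x y, on_curve f x y -> N.[x] = A2 x y * A2 x (- y)].
Proof.
have [A0 [A1 [A2 [ch [x0 [y0 [C0 nz0]]]]]]] :
    exists A0 A1 A2, chart f phi A0 A1 A2 /\ exists x y,
      on_curve f x y /\ [\/ A0 x y != 0, A1 x y != 0 | A2 x y != 0].
  by case: iso => + _ _ _; apply: morphism_chart.
have [r0 r1 r2 E] := ch.
have norm A : regular f A -> (exists x y, on_curve f x y /\ A x y != 0) ->
    exists2 N : {poly K}, N != 0 &
      forall x y, on_curve f x y -> N.[x] = A x y * A x (- y).
  exact: regular_norm.
have [nzA2|z] := boolp.pselect (exists x y, on_curve f x y /\ A2 x y != 0).
  by have [N nzN EN] := norm _ r2 nzA2; exists A0, A1, A2, N.
have z2 x y : on_curve f x y -> A2 x y = 0.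
  by move=> Cxy; apply/eqP/negPn/negP => nz; apply: z; exists x, y.
(* A is a coordinate, A0 or A1, which is nonzero somewhere. *)
have [A [rA EA [x1 [y1 [C1 nz1]]]]] : exists A, [/\ regular f A,
    forall x y, on_curve f x y ->
      exists2 t, A2 x y = t * phia x y 2 & t = 0 -> A x y = 0
    & exists x y, on_curve f x y /\ A x y != 0].
  case: nz0 => nz; last by rewrite z2 ?eqxx in nz.
    exists A0; split=> //; last by exists x0, y0.
    by move=> x y /E[t [E0 _ E2]]; exists t => // t0; rewrite E0 t0 mul0r.
  exists A1; split=> //; last by exists x0, y0.
  by move=> x y /E[t [_ E1 E2]]; exists t => // t0; rewrite E1 t0 expr0n mul0r.
have [N nzN EN] := norm A rA (ex_intro _ x1 (ex_intro _ y1 (conj C1 nz1))).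
case: (@x_image_nonconstant N 1 0) => //; first by left; rewrite oner_neq0.
move=> x y Cxy; rewrite (EN _ _ Cxy) mulf_eq0 negb_or => /andP[nzA _].
have [t E2 t0] := EA _ _ Cxy; rewrite mulr0 mulr1.
move/eqP: E2; rewrite z2 // eq_sym mulf_eq0 => /orP[/eqP/t0 A0'|/eqP //].
by rewrite A0' eqxx in nzA.
Qed.

(** This is u = (a + b y) / N, obtained from A0 / A2 by multiplying numerator
and denominator with the conjugate of A2. *)
Lemma x_image_equation :
  exists N a b, N != 0 /\ forall x y, on_curve f x y ->
    N.[x] * phia x y 0 = (a.[x] + b.[x] * y) * phia x y 2
    /\ (N.[x] != 0 -> phia x y 2 != 0).
Proof.
have [A0 [A1 [A2 [N [[r0 _ r2 E] nzN EN]]]]] := isomorphism_chart.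
have [a [b Eab]] := regularM r0 (regular_conj r2).
exists N, a, b; split=> // x y Cxy; have [t [E0 _ E2]] := E _ _ Cxy.
rewrite -Eab // (EN _ _ Cxy); split; first by rewrite E0 E2; ring.
by rewrite E2; apply: contra_neq => ->; rewrite mulr0 mul0r.
Qed.

End Pair.

Section Degree.
Variables (l m n l' m' n' : K) (phi psi : ('I_3 -> K) -> 'I_3 -> K).
Let f := branch_poly l m n.
Let g := branch_poly l' m' n'.
Let C := rosenhain_curve l m n.
Let D := rosenhain_curve l' m' n'.
Hypothesis gD : rosenhain_genus2 l' m' n'.
Hypothesis iso : mutually_inverse C D phi psi.
Notation phia x y := (phi (affine_point x y)).

(** With u the x-coordinate of phi(x, y), this produces the affine point (u, v)
that psi maps back to (x, y). *)
Lemma image_affine x y : on_curve f x y -> phia x y 2 != 0 ->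
  exists v, on_curve g (phia x y 0 / phia x y 2) v /\
    same_point (psi (affine_point (phia x y 0 / phia x y 2) v))
      (affine_point x y).
Proof.
move=> Cxy nz2'; have DQ := isomorphism_maps iso Cxy.
have CP : C (affine_point x y) by apply/rosenhain_affine.
have QQ := affine_representative nz2'.
have DQ' := same_point_curve QQ DQ.
exists (phia x y 1 / phia x y 2 ^+ 3); split; first exact/rosenhain_affine.
case: iso => _ [_ hpsi _] psiK _.
exact: same_point_trans (hpsi _ _ DQ' DQ (same_point_sym QQ)) (psiK _ CP).
Qed.

(** On D one has B0 - x B2 = 0 at (u, v), where B0 and B2 are the coordinates of
psi. The norm of this function of (u, v) only depends on u and is quadratic in
x. *)
Lemma inverse_quadratic :
  exists S : {poly {poly K}}, [/\ S != 0, (size S <= 3)%N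
    & forall x y, on_curve f x y -> phia x y 2 != 0 ->
        S.[x, phia x y 0 / phia x y 2] = 0].
Proof.
have [B0 [B1 [B2 [N [[r0 _ r2 E] nzN EN]]]]] :=
  isomorphism_chart gD (mutually_inverse_sym iso).
have [a1 [a2 Ea]] := r0; have [c1 [c2 Ec]] := r2.
pose T := - (2 * (c1 * a1 - c2 * a2 * g)); pose M := a1 ^+ 2 - a2 ^+ 2 * g.
exists (Poly [:: M; T; N]); split.
- apply/eqP => /(congr1 (fun p : {poly {poly K}} => p`_2)).
  by rewrite coef_Poly coef0 /= => /eqP; rewrite (negPf nzN).
- exact: size_Poly.
move=> x y Cxy /(image_affine Cxy)[v [Duv /same_pointE[t nzt]]].
set u := _ / _ in Duv *; rewrite /affine_point /= => -[Ex _ E1].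
have [s [E0 _ E2]] := E _ _ Duv.
have {E1} E1 : psi (affine_point u v) 2 = t^-1.
  by apply: (mulfI nzt); rewrite mulfV.
have EB : B0 u v = x * B2 u v.
  by rewrite E0 E2 Ex E1; field.
have NE : N.[u] = c1.[u] ^+ 2 - c2.[u] ^+ 2 * g.[u].
  by rewrite (EN _ _ Duv) !Ec -?Duv //; [ring | exact: on_curveN].
rewrite !horner_cons hornerC mul0r add0r !(hornerD, hornerM, hornerC) NE.
rewrite /T /M !(hornerD, hornerN, horner_exp, hornerM, hornerMn, hornerC) -Duv.
move: EB; rewrite Ea // Ec // => EB.
transitivity ((x * (c1.[u] + c2.[u] * v) - (a1.[u] + a2.[u] * v)) *
   (x * (c1.[u] - c2.[u] * v) - (a1.[u] - a2.[u] * v))).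
  by ring.
by rewrite EB subrr mul0r.
Qed.

End Degree.
End Isomorphism.

Section Moebius.
Variable K : closedFieldType.
Hypothesis nz2 : 2 != 0 :> K.

(** This is the uniqueness of the degree 2 map: u does not involve y. When
b <> 0, the two values of u above x are the roots of
N^2 t^2 - 2 a N t + (a^2 - b^2 f), whose primitive part R has degree at most 2
in x; its discriminant, (2 N b)^2 f up to a square, would be divisible by f
although its degree is at most 4. *)
Lemma x_image_even (l m n l' m' n' : K) phi psi :
    let f := branch_poly l m n in
    rosenhain_genus2 l m n -> rosenhain_genus2 l' m' n' ->
    mutually_inverse (rosenhain_curve l m n) (rosenhain_curve l' m' n') phi psi ->
  exists N a, N != 0 /\ forall x y, on_curve f x y ->
    let Q := phi (affine_point x y) in
    N.[x] * Q 0 = a.[x] * Q 2 /\ (N.[x] != 0 -> Q 2 != 0).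
Proof.
move=> f gC gD iso.
have [N [a [b [nzN E]]]] := x_image_equation gC iso.
have nzf : f != 0 by exact: branch_poly_neq0.
have [b0|nzb] := eqVneq b 0.
  by exists N, a; split=> // x y /E; rewrite b0 horner0 mul0r addr0.
exfalso.
have [S [nzS szS ES]] := inverse_quadratic gD iso.
pose M := a ^+ 2 - b ^+ 2 * f.
pose R1 := Poly [:: M; - (2 * a * N); N ^+ 2].
have nzR1 : R1 != 0.
  apply/eqP => /(congr1 (fun p : {poly {poly K}} => p`_2)).
  by rewrite coef_Poly coef0 /= => /eqP; rewrite expf_eq0 (negPf nzN).
have [G [R [nzG ER szR1 prim]]] := primitive_part_swap nzR1.
have szR : (size R <= 3)%N.
  apply: leq_trans (size_Poly [:: M; - (2 * a * N); N ^+ 2]).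
  by rewrite -/R1 szR1.
have szr : (size (swapXY R) <= 3)%N.
  apply: leq_trans szS; rewrite -[S]swapXYK.
  apply: (@degree_transfer _ (N * b * f * G)); rewrite ?swapXY_eq0 //.
    by rewrite !mulf_neq0.
  move=> x; rewrite !hornerM !mulf_eq0 !negb_or.
  move=> /andP[/andP[/andP[Nx bx] fx] Gx].
  have [y Cxy] := on_curve_exists f x; have Cxy' := on_curveN Cxy.
  have nzy : y != 0 by apply: contra_neq fx => y0; rewrite -Cxy y0 expr0n.
  have root z : on_curve f x z -> let Q := phi (affine_point x z) in
      [/\ Q 0 / Q 2 = (a.[x] + b.[x] * z) / N.[x], R.[Q 0 / Q 2, x] = 0 &
          (swapXY S).[Q 0 / Q 2, x] = 0].
    move=> Cxz Q; have [EQ /(_ Nx) nzQ2] := E _ _ Cxz.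
    have u_eq : Q 0 / Q 2 = (a.[x] + b.[x] * z) / N.[x].
      by apply/eqP; rewrite eqr_div // mulrC EQ.
    split=> //; last by rewrite horner2_swapXY ES.
    apply: (mulfI Gx); rewrite mulr0 -hornerM.
    have -> : G * R.[(Q 0 / Q 2)%:P] = R1.[(Q 0 / Q 2)%:P].
      by rewrite ER hornerM hornerC.
    rewrite /R1 !horner_cons hornerC mul0r add0r u_eq.
    rewrite /M !(hornerD, hornerN, horner_exp, hornerM, hornerMn, hornerC).
    by rewrite -Cxz; field.
  have [u1 R1u S1] := root _ Cxy; have [u2 R2u S2] := root _ Cxy'.
  exists [:: phi (affine_point x y) 0 / phi (affine_point x y) 2;
             phi (affine_point x (- y)) 0 / phi (affine_point x (- y)) 2].
  split=> //; last by move=> t; rewrite !inE => /orP[]/eqP ->.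
  rewrite /= inE andbT u1 u2; apply/eqP => /(mulIf (invr_neq0 Nx))/addrI.
  move/(mulfI bx)/eqP; rewrite -subr_eq0 opprK -mulr2n -mulr_natl mulf_eq0.
  by rewrite (negPf nz2) (negPf nzy).
have szRi i : (size (R`_i)%R <= 3)%N.
  by rewrite (leq_trans (max_size_coefXY _ _)) // sizeYE.
have ERi i : R1`_i = G * R`_i by rewrite ER mul_polyC coefZ.
pose disc := R`_1 ^+ 2 - 4 * (R`_0 * R`_2).
have sz_sq (p q : {poly K}) :
    (size p <= 3)%N -> (size q <= 3)%N -> (size (p * q)%R <= 5)%N.
  move=> szp szq; apply: leq_trans (size_polyMleq _ _) _.
  by rewrite -subn1 leq_subLR; apply: leq_add szp szq.
have sz_disc : (size disc <= 5)%N.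
  apply: leq_trans (size_polyD _ _) _; rewrite geq_max size_polyN expr2 sz_sq //=.
  by rewrite -[4]polyC_natr mul_polyC (leq_trans (size_scale_leq _ _)) ?sz_sq.
have Edisc : (2 * N * b) ^+ 2 * f = G ^+ 2 * disc.
  have := (ERi 0, ERi 1%N, ERi 2); rewrite /R1 !coef_Poly /= => -[[E0 E1] E2].
  rewrite /disc mulrBr -exprMn -E1.
  transitivity ((- (2 * a * N)) ^+ 2 - 4 * (M * N ^+ 2)); first by rewrite /M; ring.
  by rewrite E0 E2; ring.
have /dvdp_leq : f %| disc by apply: squarefree_dvd_odd_part Edisc.
rewrite size_branch_poly => szf.
have disc0 : disc = 0.
  by apply/eqP/negPn/negP => /szf /leq_trans/(_ sz_disc).
move/eqP: Edisc; rewrite disc0 mulr0 mulf_eq0 (negPf nzf) orbF expf_eq0 /=.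
rewrite !mulf_eq0 (negPf nzN) (negPf nzb) !orbF.
by rewrite -[2]polyC_natr polyC_eq0 (negPf nz2).
Qed.

Definition linear_poly (s t : K) : {poly K} := s *: 'X + t%:P.

Lemma horner_linear_poly s t x : (linear_poly s t).[x] = s * x + t.
Proof. by rewrite /linear_poly !hornerE. Qed.

Lemma linear_polyE (p : {poly K}) : (size p <= 2)%N -> p = linear_poly p`_1 p`_0.
Proof.
move=> szp; apply/polyP => i; rewrite coefD coefZ coefX coefC.
case: i => [|[|i]] /=; rewrite ?mulr0 ?mulr1 ?add0r ?addr0 //.
by rewrite nth_default // (leq_trans szp).
Qed.

(** Both u as a function of x and x as a function of u are rational. Now R is
linear in t and S is linear in x, so the numerator and denominator of u in
lowest terms have degree at most 1. *)
Lemma x_image_moebius (l m n l' m' n' : K) phi psi :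
    let f := branch_poly l m n in
    rosenhain_genus2 l m n -> rosenhain_genus2 l' m' n' ->
    mutually_inverse (rosenhain_curve l m n) (rosenhain_curve l' m' n') phi psi ->
  exists m11 m12 m21 m22 (e : {poly K}),
    [/\ m11 * m22 - m12 * m21 != 0, e != 0
      & forall x y, on_curve f x y -> e.[x] != 0 ->
        let Q := phi (affine_point x y) in
        (m21 * x + m22) * Q 0 = (m11 * x + m12) * Q 2].
Proof.
move=> f gC gD iso.
have [N [a [nzN E]]] := x_image_even gC gD iso.
have [N' [a' [nzN' E']]] := x_image_even gD gC (mutually_inverse_sym iso).
pose R1 := Poly [:: - a; N]; pose S := Poly [:: - a'; N'].
have szS : (size S <= 2)%N by exact: size_Poly.
have nzS : S != 0.
  apply/eqP => /(congr1 (fun p : {poly {poly K}} => p`_1)).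
  by rewrite coef_Poly coef0 /= => /eqP; rewrite (negPf nzN').
have nzR1 : R1 != 0.
  apply/eqP => /(congr1 (fun p : {poly {poly K}} => p`_1)).
  by rewrite coef_Poly coef0 /= => /eqP; rewrite (negPf nzN).
have [G [R [nzG ER szR1 prim]]] := primitive_part_swap nzR1.
have szR : (size R <= 2)%N.
  apply: leq_trans (size_Poly [:: - a; N]).
  by rewrite -/R1 szR1.
have ERi i : R1`_i = G * R`_i by rewrite ER mul_polyC coefZ.
have := (ERi 0, ERi 1%N); rewrite /R1 !coef_Poly /= => -[E0 E1'].
have REx t x : R.[t, x] = (R`_1).[x] * t + (R`_0).[x].
  rewrite (horner_coef_wide _ szR) big_ord_recr big_ord1 /= expr0 expr1 mulr1.
  by rewrite hornerD hornerM hornerC addrC.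
have szr : (size (swapXY R) <= 2)%N.
  apply: leq_trans szS; rewrite -[S]swapXYK.
  apply: (@degree_transfer _ (N * G)); rewrite ?swapXY_eq0 ?mulf_neq0 //.
  move=> x; rewrite hornerM mulf_eq0 negb_or => /andP[Nx Gx].
  have [y Cxy] := on_curve_exists f x.
  have [EQ /(_ Nx) nzQ2] := E _ _ Cxy.
  have [v [Duv /same_pointE[t nzt []]]] := image_affine iso Cxy nzQ2.
  set u := _ / _ in Duv *; rewrite /affine_point /= => Ex _ E1.
  exists [:: u]; split=> // z; rewrite inE => /eqP ->; split.
    apply: (mulfI Gx); rewrite mulr0 REx mulrDr !mulrA -!hornerM -E0 -E1'.
    by rewrite hornerN EQ mulfK // subrr.
  rewrite horner2_swapXY /S !horner_cons hornerC mul0r add0r.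
  rewrite !(hornerD, hornerM, hornerC).
  have [+ _] := E' _ _ Duv; rewrite /affine_point Ex hornerN => E''.
  have nz2' : psi (affine_point u v) 2 != 0.
    by apply: contraNneq (oner_neq0 K) => z2; rewrite E1 /affine_point z2 mulr0.
  apply: (mulIf nz2'); rewrite mul0r mulrDl mulNr -E''.
  rewrite -[N'.[u] * (t * _) * _]mulrA [t * _ * _]mulrAC -E1 mul1r.
  by rewrite addrN.
have szRi i : (size (R`_i)%R <= 2)%N.
  by rewrite (leq_trans (max_size_coefXY _ _)) // sizeYE.
have E1x := linear_polyE (szRi 1%N); have E0x := linear_polyE (szRi 0).
move: E1x E0x; set m21 := (R`_1)`_1; set m22 := (R`_1)`_0.
set m11 := (R`_0)`_1; set m12 := (R`_0)`_0 => E1x E0x.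
have MQ x y : on_curve f x y -> G.[x] != 0 -> let Q := phi (affine_point x y) in
    (m21 * x + m22) * Q 0 = (- m11 * x - m12) * Q 2.
  move=> Cxy Gx Q; have [EQ _] := E _ _ Cxy; apply: (mulfI Gx).
  rewrite -horner_linear_poly -E1x mulrA -hornerM -E1' EQ.
  by rewrite -(opprK a) E0 E0x hornerN hornerM horner_linear_poly -/Q; ring.
have prim_x x : (m21 * x + m22 != 0) \/ (m11 * x + m12 != 0).
  apply/orP; rewrite -negb_and; apply/negP => /andP[/eqP z1 /eqP z0].
  case/eqP: (prim x); rewrite horner_swapXY; apply/polyP => i.
  rewrite coef0 coef_map /= /horner_eval; case: i => [|[|i]].
  - by rewrite E0x horner_linear_poly.
  - by rewrite E1x horner_linear_poly.
  - by rewrite nth_default ?horner0 // (leq_trans szR).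
exists (- m11), (- m12), m21, m22, G; split=> //.
apply/eqP => det0.
(* A vanishing determinant and coprimality leave only constants. *)
have [m21_0 m11_0] : m21 = 0 /\ m11 = 0.
  split; apply/eqP/negPn/negP => nz.
    have z1 : m21 * (- m22 / m21) + m22 = 0 by field.
    have z0 : m11 * (- m22 / m21) + m12 = 0.
      apply: (mulIf nz); rewrite mul0r.
      by transitivity (- m11 * m22 - - m12 * m21); first by field.
    by have [] := prim_x (- m22 / m21); rewrite ?z0 ?z1 eqxx.
  have z0 : m11 * (- m12 / m11) + m12 = 0 by field.
  have z1 : m21 * (- m12 / m11) + m22 = 0.
    apply: (mulIf nz); rewrite mul0r.
    transitivity (- (- m11 * m22 - - m12 * m21)); first by field.
    by rewrite det0 oppr0.
  by have [] := prim_x (- m12 / m11); rewrite ?z0 ?z1 eqxx.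
apply: (@x_image_nonconstant _ _ _ _ _ _ _ _ _ iso G (- m12) m22) => //.
  by have [] := prim_x 0; rewrite mulr0 add0r; [right | left; rewrite oppr_eq0].
move=> x y Cxy /(MQ _ _ Cxy); rewrite m21_0 m11_0 oppr0 !mul0r !add0r => E2.
by rewrite mulrC E2 mulrC.
Qed.

End Moebius.

(** * The action on branch points *)

(** Homogeneous coordinates (x, 1) of the branch points, with (1, 0) at
infinity; index 5 is the parameter in which neighbouring curves differ. *)
Definition branch_point (R : nzRingType) (l m n : R) (i : nat) : R * R :=
  nth (0, 0) [:: (1, 0); (0, 1); (1, 1); (l, 1); (m, 1); (n, 1)] i.

Lemma branch_point_affine (R : nzRingType) (l m n : R) i :
  (i < 5)%N -> branch_point l m n i.+1 = ([:: 0; 1; l; m; n]`_i, 1).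
Proof. by case: i => [|[|[|[|[|]]]]]. Qed.

(** The matrix m acts on the projective line, and bilin m v w vanishes when
m v and w represent the same point. *)
Definition bilin (R : comNzRingType) (m : R * R * R * R) (v w : R * R) : R :=
  let: (m11, m12, m21, m22) := m in
  (m11 * v.1 + m12 * v.2) * w.2 - (m21 * v.1 + m22 * v.2) * w.1.

Definition bilin_det (R : comNzRingType) (m : R * R * R * R) : R :=
  let: (m11, m12, m21, m22) := m in m11 * m22 - m12 * m21.

Section Branch.
Variable K : closedFieldType.
Hypothesis nz2 : 2 != 0 :> K.

(** The sextic form that defines the curve, at (a : c). *)
Definition branch_pullback (l m n : K) (a c : {poly K}) : {poly K} :=
  c * \prod_(z <- [:: 0; 1; l; m; n]) (a - z *: c).

Lemma horner_branch_pullback (l m n : K) a c x :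
  (branch_pullback l m n a c).[x] = sextic_form l m n a.[x] c.[x].
Proof.
rewrite /branch_pullback hornerM !big_cons big_nil !hornerM.
rewrite !(hornerD, hornerN, hornerZ, hornerC).
by rewrite /sextic_form; ring.
Qed.

Lemma linear_polyB (s t s' t' z : K) :
  linear_poly s t - z *: linear_poly s' t'
    = linear_poly (s - z * s') (t - z * t').
Proof.
rewrite /linear_poly scalerDr scalerA opprD addrACA -scalerBl.
by rewrite scale_polyC -polyCB.
Qed.

Lemma size_linear_poly (s t : K) : s != 0 -> size (linear_poly s t) = 2%N.
Proof.
move=> nzs; have szX : size (s *: 'X) = 2%N by rewrite size_scale // size_polyX.
by rewrite /linear_poly size_polyDl szX // ltnS size_polyC_leq1.
Qed.

Lemma size_mul_linear (s t : K) (p : {poly K}) :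
  s != 0 -> p != 0 -> size (linear_poly s t * p) = (size p).+1.
Proof.
move=> nzs nzp; have szl := size_linear_poly t nzs.
by rewrite size_mul ?szl // -size_poly_eq0 szl.
Qed.

Lemma size_prod_linear (a c : K -> K) (zs : seq K) :
    {in zs, forall z, a z != 0} ->
  size (\prod_(z <- zs) linear_poly (a z) (c z)) = (size zs).+1.
Proof.
elim: zs => [|z zs IHzs] nza; first by rewrite big_nil size_poly1.
have IH : size (\prod_(z <- zs) linear_poly (a z) (c z)) = (size zs).+1.
  by apply: IHzs => x xs; apply: nza; rewrite inE xs orbT.
rewrite big_cons size_mul_linear ?IH //; first by apply: nza; rewrite mem_head.
by rewrite -size_poly_eq0 IH.
Qed.

Lemma odd_size_sqr (p : {poly K}) : p != 0 -> odd (size (p ^+ 2)).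
Proof.
move=> nzp; have := size_exp p 2; rewrite muln2.
have : (0 < size (p ^+ 2))%N by rewrite size_poly_gt0 expf_neq0.
by case: (size _) => //= k _ ->; rewrite odd_double.
Qed.

(** The last two conclusions say that f and H cut out the same branch divisor
on the projective line: the finite branch points are roots of H, and H has a
root at infinity when its degree is less than 6. *)
Lemma isomorphism_branch_divisor (l m n l' m' n' : K) phi psi :
    let f := branch_poly l m n in
    rosenhain_genus2 l m n -> rosenhain_genus2 l' m' n' ->
    mutually_inverse (rosenhain_curve l m n) (rosenhain_curve l' m' n') phi psi ->
  exists m11 m12 m21 m22,
    let H := branch_pullback l' m' n'
               (linear_poly m11 m12) (linear_poly m21 m22) in
    [/\ m11 * m22 - m12 * m21 != 0, f %| H & size H != 7%N].
Proof.
move=> f gC gD iso.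
have [m11 [m12 [m21 [m22 [e [det nze EM]]]]]] := x_image_moebius nz2 gC gD iso.
have [A0 [A1 [A2 [N [[r0 r1 r2 E] nzN EN]]]]] := isomorphism_chart gC iso.
exists m11, m12, m21, m22.
set a := linear_poly m11 m12; set c := linear_poly m21 m22 => H.
have nzf : f != 0 by exact: branch_poly_neq0.
have nzc : c != 0.
  apply: contraNneq det => c0; rewrite /c in c0.
  have c00 : m22 = 0.
    have := congr1 (horner^~ 0) c0.
    by rewrite horner_linear_poly mulr0 add0r horner0.
  have c01 : m21 = 0.
    have := congr1 (horner^~ 1) c0.
    by rewrite horner_linear_poly c00 mulr1 addr0 horner0.
  by rewrite c00 c01 !mulr0 subrr.
(* The second coordinate w of phi is A1 / A2^3 up to the factor c^3; clearing
   denominators with the conjugate of A2 keeps it regular. *)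
have [p [q Epq]] := regularM (regularM r1 (regular_poly f (c ^+ 3)))
                             (regularX 3 (regular_conj r2)).
have sqE x y : on_curve f x y -> e.[x] != 0 ->
    (p.[x] + q.[x] * y) ^+ 2 = (N ^+ 6 * H).[x].
  move=> Cxy ex; have := EM _ _ Cxy ex; rewrite -!horner_linear_poly -/a -/c.
  have [t [E0 E1 E2]] := E _ _ Cxy.
  have [_ /= +] := isomorphism_maps iso Cxy.
  move: E0 E1 E2; set Q := phi _ => E0 E1 E2 EQ EcQ.
  have EQ' : Q 1 ^+ 2 = sextic_form l' m' n' (Q 0) (Q 2) by [].
  have cG : c.[x] ^+ 6 * Q 1 ^+ 2 = Q 2 ^+ 6 * H.[x].
    rewrite horner_branch_pullback EQ' -!sextic_formZ.
    congr sextic_form; last by rewrite mulrC.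
    by rewrite EcQ mulrC.
  rewrite -Epq // [RHS]hornerM [(N ^+ 6).[x]]horner_exp (EN _ _ Cxy).
  rewrite [(c ^+ 3).[x]]horner_exp E1 E2.
  transitivity (t ^+ 6 * (c.[x] ^+ 6 * Q 1 ^+ 2) * A2 x (- y) ^+ 6).
    by ring.
  by rewrite cG; ring.
have [sum0 pq0] : p ^+ 2 + q ^+ 2 * f - N ^+ 6 * H = 0 /\ 2 * p * q = 0.
  apply: (regular_eq0 nz2 nzf nze) => x y Cxy ex.
  transitivity ((p.[x] + q.[x] * y) ^+ 2 - (N ^+ 6 * H).[x]).
    by rewrite !(horner_exp, hornerD, hornerN, hornerM, hornerC) -Cxy; ring.
  by rewrite (sqE _ _ Cxy ex) subrr.
(* If q = 0 then w takes the same value at (x, y) and (x, -y), and so does u. *)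
have nzq : q != 0.
  apply/eqP => q0.
  have [x] : exists x, (N * c * f * e).[x] != 0.
    by apply: exists_nonroot; rewrite !mulf_neq0.
  rewrite !hornerM !mulf_eq0 !negb_or => /andP[/andP[/andP[Nx cx] fx] ex].
  have [y Cxy] := on_curve_exists f x; have Cxy' := on_curveN Cxy.
  have nzy : y != 0 by apply: contra_neq fx => y0; rewrite -Cxy y0 expr0n.
  have [t [E0 E1 E2]] := E _ _ Cxy; have [s [F0 F1 F2]] := E _ _ Cxy'.
  have := Epq _ _ Cxy; rewrite q0 horner0 mul0r addr0 => Ep.
  have := Epq _ _ Cxy'; rewrite q0 horner0 mul0r addr0 opprK -Ep => {}Ep.
  have := EM _ _ Cxy ex; have := EM _ _ Cxy' ex.
  rewrite -!horner_linear_poly -/a -/c.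
  move: Nx; rewrite (EN _ _ Cxy) mulf_eq0 negb_or => /andP[].
  move: E1 E2 F1 F2 Ep; rewrite horner_exp.
  set Q := phi _; set Q' := phi _ => E1 E2 F1 F2.
  rewrite E1 E2 F1 F2 !mulf_eq0 !negb_or.
  move=> Ep /andP[nzt nzQ2] /andP[nzs nzQ2'] EQ' EQ.
  have [] : x = x /\ y = - y.
    apply: (isomorphism_inj iso) => //; rewrite -/Q -/Q'; apply/same_pointE.
    exists (Q' 2 / Q 2); first by rewrite mulf_neq0 ?invr_eq0.
    split; last by rewrite divfK.
      apply: (mulfI cx); rewrite EQ' mulrCA EQ; field.
      exact: nzQ2.
    apply: (mulIf (_ : (t * s) ^+ 3 * c.[x] ^+ 3 * Q 2 ^+ 3 != 0)).
      by rewrite !mulf_neq0 ?expf_neq0 ?mulf_neq0.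
    transitivity (s ^+ 3 * Q' 1 * c.[x] ^+ 3 * (t * Q 2) ^+ 3); first by ring.
    by rewrite Ep; field.
  move=> _ /eqP; rewrite -subr_eq0 opprK -mulr2n -mulr_natl mulf_eq0.
  by rewrite (negPf nz2) (negPf nzy).
have p0 : p = 0.
  move/eqP: pq0; rewrite !mulf_eq0 (negPf nzq) orbF.
  by rewrite -[2]polyC_natr polyC_eq0 (negPf nz2) => /eqP.
have EH : q ^+ 2 * f = (N ^+ 3) ^+ 2 * H.
  by move/subr0_eq: sum0; rewrite p0 expr0n add0r -exprM.
have nzN3 : N ^+ 3 != 0 by rewrite expf_neq0.
have fH : f %| H by apply: squarefree_dvd_odd_part EH.
split=> //; apply/eqP => szH.
have nzH : H != 0 by rewrite -size_poly_eq0 szH.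
move: EH => /(congr1 (fun p : {poly K} => odd (size p))).
rewrite /= [size (q ^+ 2 * f)]size_mul ?expf_neq0 // size_branch_poly.
rewrite [size (_ * H)]size_mul ?expf_neq0 // szH !addnS /= !addn0 /=.
by rewrite !odd_size_sqr.
Qed.

(** The parity of the degree of H settles the point at infinity: if it did not
go to a branch point, each of the six linear factors of H would have degree
exactly 1. *)
Lemma isomorphism_bilin (l m n l' m' n' : K) :
    rosenhain_genus2 l m n -> rosenhain_genus2 l' m' n' ->
    curve_isomorphic (rosenhain_curve l m n) (rosenhain_curve l' m' n') ->
  exists2 M, bilin_det M != 0 &
    forall i : 'I_6, exists j : 'I_6,
      bilin M (branch_point l m n i) (branch_point l' m' n' j) = 0.
Proof.
move=> gC gD [phi [psi iso]].
have [m11 [m12 [m21 [m22 [det fH szH]]]]] :=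
  isomorphism_branch_divisor gC gD iso.
pose M := (m11, m12, m21, m22); exists M => //.
have rootH x : x \in [:: 0; 1; l; m; n] -> exists j : 'I_6,
    bilin M (x, 1) (branch_point l' m' n' j) = 0.
  move=> xb; have : root (branch_pullback l' m' n'
                       (linear_poly m11 m12) (linear_poly m21 m22)) x.
    by rewrite -dvdp_XsubCl (dvdp_trans _ fH) // dvdp_XsubCl root_prod_XsubC.
  rewrite /root horner_branch_pullback !horner_linear_poly /sextic_form.
  rewrite !mulf_eq0 /=.
  have mk j (ltj : (j < 6)%N) :
      bilin M (x, 1) (branch_point l' m' n' j) = 0 ->
      exists j : 'I_6, bilin M (x, 1) (branch_point l' m' n' j) = 0.
    by exists (Ordinal ltj).
  rewrite -!orbA => /or4P[|||/or3P[]] /eqP h.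
  - by apply: (mk 0%N) => //; rewrite /= mulr0 !mulr1 h subrr.
  - by apply: (mk 1%N) => //; rewrite /= mulr0 !mulr1 h subr0.
  - by apply: (mk 2) => //; rewrite /= !mulr1.
  - by apply: (mk 3) => //; rewrite /= !mulr1 [_ * l']mulrC.
  - by apply: (mk 4) => //; rewrite /= !mulr1 [_ * m']mulrC.
  - by apply: (mk 5) => //; rewrite /= !mulr1 [_ * n']mulrC.
case; case=> [|i] lti; last first.
  have : [:: 0; 1; l; m; n]`_i \in [:: 0; 1; l; m; n] by rewrite mem_nth.
  by move=> /rootH[j Ej]; exists j; rewrite branch_point_affine.
apply: boolp.contrapT => noinf; move/eqP: szH; apply.
have nzB (w : K * K) : (exists j : 'I_6, branch_point l' m' n' j = w) ->
    m11 * w.2 - m21 * w.1 != 0.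
  move=> [j Ej]; apply: contra_not_neq noinf => h.
  by exists j; rewrite Ej /= !mulr1 !mulr0 !addr0.
have nz21 : m21 != 0.
  have := nzB (1, 0); rewrite /= mulr0 mulr1 sub0r oppr_eq0; apply.
  by exists (@Ordinal 6 0 isT).
have nzz z : z \in [:: 0; 1; l'; m'; n'] -> m11 - z * m21 != 0.
  move=> zb; have := nzB (z, 1); rewrite /= mulr1 [_ * z]mulrC; apply.
  have ltz : (index z [:: 0%R; 1%R; l'; m'; n'] < 5)%N by rewrite index_mem.
  by exists (@Ordinal 6 _.+1 ltz); rewrite branch_point_affine // nth_index.
rewrite /branch_pullback (eq_bigr _ (fun z _ => linear_polyB m11 m12 m21 m22 z)).
have szP := size_prod_linear (fun z => m12 - z * m22) nzz.
by rewrite size_mul_linear ?szP // -size_poly_eq0 szP.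
Qed.
End Branch.

(** * Cross-ratios *)
Definition bracket (R : comNzRingType) (v w : R * R) : R := v.1 * w.2 - v.2 * w.1.

Definition nth_bracket (R : comNzRingType) (c : seq (R * R)) (i j : nat) : R :=
  bracket (nth (0, 0) c i) (nth (0, 0) c j).

(** The cross-ratios of a and b agree exactly when this polynomial in their
coordinates vanishes. *)
Definition cross_ratio_gap (R : comNzRingType) (a b : seq (R * R)) : R :=
  nth_bracket a 0 2 * nth_bracket a 1 3 * (nth_bracket b 0 3 * nth_bracket b 1 2)
  - nth_bracket a 0 3 * nth_bracket a 1 2 * (nth_bracket b 0 2 * nth_bracket b 1 3).

Section Bilin.
Variable (K : fieldType) (M : K * K * K * K).
Hypothesis det : bilin_det M != 0.
Implicit Types v w : K * K.

Let im v : K * K :=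
  let: (m11, m12, m21, m22) := M in (m11 * v.1 + m12 * v.2, m21 * v.1 + m22 * v.2).

Let bilinE v w : bilin M v w = bracket (im v) w.
Proof. by rewrite /bilin /im; case: M => -[[m11 m12] m21] m22. Qed.

Let bracket_im v w : bracket (im v) (im w) = bilin_det M * bracket v w.
Proof.
rewrite /im /bilin_det; case: M => -[[m11 m12] m21] m22.
by rewrite /bracket /=; ring.
Qed.

Lemma bracket0P v w : w != 0 -> bracket v w = 0 -> exists t, v = (t * w.1, t * w.2).
Proof.
case: v w => [v1 v2] [w1 w2]; rewrite /bracket /= => nzw /subr0_eq E.
have [w10|nz1] := eqVneq w1 0.
  have nz2 : w2 != 0 by apply: contraNneq nzw => w20; rewrite w10 w20.
  exists (v2 / w2); rewrite w10 mulr0 divfK //.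
  by move/eqP: E; rewrite w10 mulr0 mulf_eq0 (negPf nz2) orbF => /eqP ->.
by exists (v1 / w1); rewrite divfK // mulrAC E mulfK.
Qed.

Lemma bilin_cross_ratio_gap (a b : seq (K * K)) :
    (forall i, (i < 4)%N ->
       nth (0, 0) b i != 0 /\ bilin M (nth (0, 0) a i) (nth (0, 0) b i) = 0) ->
  cross_ratio_gap a b = 0.
Proof.
move=> ab.
have im_a i : (i < 4)%N -> exists t, im (nth (0, 0) a i) =
    (t * (nth (0, 0) b i).1, t * (nth (0, 0) b i).2).
  by move=> /ab[nzb]; rewrite bilinE; exact: bracket0P.
have [t0 E0] := im_a 0%N isT; have [t1 E1] := im_a 1%N isT.
have [t2 E2] := im_a 2%N isT; have [t3 E3] := im_a 3%N isT.
apply: (mulfI det); apply: (mulfI det); rewrite !mulr0.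
pose im_br i j := bracket (im (nth (0, 0) a i)) (im (nth (0, 0) a j)).
rewrite /cross_ratio_gap; transitivity (
  im_br 0%N 2%N * im_br 1%N 3%N * (nth_bracket b 0 3 * nth_bracket b 1 2)
  - im_br 0%N 3%N * im_br 1%N 2%N * (nth_bracket b 0 2 * nth_bracket b 1 3)).
  by rewrite /im_br !bracket_im /nth_bracket; ring.
by rewrite /im_br /nth_bracket E0 E1 E2 E3 /bracket /=; ring.
Qed.

Lemma bracketC v w : bracket v w = - bracket w v.
Proof. by rewrite /bracket; ring. Qed.

Lemma bilin_inj_l v v' w : w != 0 ->
  bilin M v w = 0 -> bilin M v' w = 0 -> bracket v v' = 0.
Proof.
rewrite !bilinE => nzw /(bracket0P nzw)[t Et] /(bracket0P nzw)[t' Et'].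
apply: (mulfI det); rewrite -bracket_im Et Et' mulr0 /bracket /=; ring.
Qed.

Lemma bilin_inj_r v w w' : v != 0 ->
  bilin M v w = 0 -> bilin M v w' = 0 -> bracket w w' = 0.
Proof.
move=> nzv; rewrite !bilinE => E E'.
have nzi : im v != 0.
  apply: contraNneq nzv => i0; have h u : bracket v u = 0.
    by apply: (mulfI det); rewrite -bracket_im i0 /bracket /=; ring.
  have := h (0, 1); have := h (1, 0); rewrite /bracket /= !mulr0 !mulr1 sub0r subr0.
  by move=> /eqP; rewrite oppr_eq0; case: v {i0 h E E'} => v1 v2 /= /eqP -> ->.
have sym u : bracket (im v) u = 0 -> bracket u (im v) = 0.
  by rewrite bracketC => /eqP; rewrite oppr_eq0 => /eqP.
have [t ->] := bracket0P nzi (sym _ E); have [t' ->] := bracket0P nzi (sym _ E').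
by rewrite /bracket /=; ring.
Qed.

(** A transformation with three fixed points is the identity. This is the
invariance of the cross-ratio of (v1, v2, v3, v), read through the Pluecker
relation between brackets. *)
Lemma bilin_fix3 v1 v2 v3 v w :
    bracket v1 v2 != 0 -> bracket v1 v3 != 0 -> bracket v2 v3 != 0 -> w != 0 ->
    bilin M v1 v1 = 0 -> bilin M v2 v2 = 0 -> bilin M v3 v3 = 0 ->
    bilin M v w = 0 ->
  bracket v w = 0.
Proof.
move=> n12 n13 n23 nzw B1 B2 B3 B.
have nz0 (u u' : K * K) : bracket u u' != 0 -> u != 0 /\ u' != 0.
  by move=> nz; split; apply: contraNneq nz => ->; rewrite /bracket /=; apply/eqP; ring.
have [nz1 nz2] := nz0 _ _ n12; have [_ nz3] := nz0 _ _ n13.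
have : cross_ratio_gap [:: v1; v2; v3; v] [:: v1; v2; v3; w] = 0.
  by apply: bilin_cross_ratio_gap => -[|[|[|[|]]]].
rewrite /cross_ratio_gap /nth_bracket /= => E.
apply: (mulfI n12); apply: (mulfI n13); apply: (mulfI n23).
by apply: oppr_inj; rewrite !mulr0 oppr0 -E /bracket; ring.
Qed.

(** A transformation swapping two points has trace zero, hence is an involution,
which for the bilinear form means symmetry. *)
Lemma bilin_swap v w : bracket v w != 0 -> bilin M v w = 0 -> bilin M w v = 0 ->
  forall x y, bilin M x y = bilin M y x.
Proof.
have tr x y : bilin M x y - bilin M y x = (M.1.1.1 + M.2) * bracket x y.
  by rewrite /bilin /bracket; case: M => -[[m11 m12] m21] m22 /=; ring.
move=> nz B B' x y; have /eqP := tr v w.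
rewrite B B' subrr eq_sym mulf_eq0 (negPf nz) orbF.
by move=> /eqP t0; apply/subr0_eq; rewrite tr t0 mul0r.
Qed.
End Bilin.

(** * Permutations of the six branch points *)
Section Combinatorics.
Local Open Scope nat_scope.

Definition omit s := [seq i <- iota 0 5 | i != s].
Definition quadruples := [seq take 4 b | b <- permutations (iota 0 5)].
(** The reorderings that preserve the cross-ratio of any four points. *)
Definition klein_orbit (a : seq nat) :=
  if a is [:: p; q; r; s]
  then [:: [:: p; q; r; s]; [:: q; p; s; r]; [:: r; s; p; q]; [:: s; r; q; p]]
  else [::].
(** Pairs of quadruples among the five shared branch points whose cross-ratios
are different functions of the parameters; it is enough to let the first
quadruple be in increasing order. *)
Definition quadruple_pairs :=
  [seq (a, b) | a <- [seq omit s | s <- iota 0 5],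
                b <- [seq b <- quadruples | b \notin klein_orbit a]].

Lemma quadruple_pairsP a b : (a, b) \in quadruple_pairs ->
  size a = 4 /\ all (fun i => i < 5) b.
Proof.
have : all (fun ab => (size ab.1 == 4) && all (fun i => i < 5) ab.2)
  quadruple_pairs.
  by vm_compute.
by move=> /allP h /h /andP[/eqP].
Qed.

Definition matches_quadruples (p : seq nat) :=
  has (fun s => (omit s, [seq nth 0 p i | i <- omit s]) \in quadruple_pairs)
      (iota 0 5).
Definition fixes_three (p : seq nat) :=
  has (fun i => has (fun j => has (fun k =>
    [&& i < j, j < k, nth 0 p i == i, nth 0 p j == j & nth 0 p k == k])
    (iota 0 5)) (iota 0 5)) (iota 0 5).
Definition swaps_two (p : seq nat) :=
  has (fun s => [&& nth 0 p s == 5, nth 0 p 5 == s &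
    has (fun i => [&& nth 0 p i < 5, nth 0 p i != i
                    & nth 0 p (nth 0 p i) == i]) (iota 0 5)])
    (iota 0 5).

(** Index 5 stands for n in the source and for n' in the target. A permutation p
that matches no pair of quadruples preserves the cross-ratio formally, which
leaves two kinds: it fixes three shared points, or it acts as an involution on
four shared points and exchanges the fifth one with index 5. All 720 cases are
checked by computation. *)
Lemma permutation_trichotomy p : p \in permutations (iota 0 6) ->
  [\/ matches_quadruples p, fixes_three p | swaps_two p].
Proof.
move=> pin.
have : all (fun p => [|| matches_quadruples p, fixes_three p | swaps_two p])
  (permutations (iota 0 6)) by vm_compute.
by move=> /allP/(_ p pin)/or3P.
Qed.

End Combinatorics.

(** * Counting special parameters *)

(** The polynomial in the parameters x and y which vanishes when the quadruples
ab.1 and ab.2 of the points oo, 0, 1, x, y have the same cross-ratio. *)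
Definition quadruple_gap (R : comNzRingType) (x y : R)
    (ab : seq nat * seq nat) : R :=
  cross_ratio_gap [seq branch_point x y 0 i | i <- ab.1]
                  [seq branch_point x y 0 i | i <- ab.2].

Lemma quadruple_gap_rmorph (R S : comNzRingType) (h : {rmorphism R -> S}) x y ab :
  quadruple_gap (h x) (h y) ab = h (quadruple_gap x y ab).
Proof.
pose hh (v : R * R) := (h v.1, h v.2).
have hbp i : branch_point (h x) (h y) 0 i = hh (branch_point x y 0 i).
  by rewrite /hh /branch_point; case: i => [|[|[|[|[|[|i]]]]]] /=;
    rewrite ?nth_nil /= ?rmorph0 ?rmorph1.
have hnth s i : nth (0, 0) [seq branch_point (h x) (h y) 0 i | i <- s] i =
    hh (nth (0, 0) [seq branch_point x y 0 i | i <- s] i).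
  rewrite (eq_map hbp) map_comp; have [lti|gei] := ltnP i (size s).
    by rewrite (nth_map (0, 0)) // size_map.
  by rewrite !nth_default ?size_map // /hh rmorph0.
have hbr s i j : nth_bracket [seq branch_point (h x) (h y) 0 i | i <- s] i j =
    h (nth_bracket [seq branch_point x y 0 i | i <- s] i j).
  by rewrite /nth_bracket !hnth /hh /bracket rmorphB !rmorphM.
by rewrite /quadruple_gap /cross_ratio_gap !hbr -!rmorphM -rmorphB.
Qed.

Definition is_small_pow2 (z : int) := `|z|%N \in [seq 2 ^ k | k <- iota 0 5]%N.

(** For each pair of quadruples, one of the nine points of the grid {0, 1, 2}^2
gives plus or minus a power of 2. This certifies that the polynomial is nonzero
in every odd characteristic at once. *)
Lemma quadruple_gap_pow2 :
  all (fun ab => has (fun i => has (fun j =>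
      is_small_pow2 (quadruple_gap (Posz i) (Posz j) ab))
    (iota 0 3)) (iota 0 3)) quadruple_pairs.
Proof. by vm_compute. Qed.

Lemma quadruple_gap_neq0 (R : comUnitRingType) ab :
    (2 : R) \is a GRing.unit -> ab \in quadruple_pairs ->
  exists i j : nat, quadruple_gap (i%:R : R) j%:R ab != 0.
Proof.
move=> u2 /(allP quadruple_gap_pow2)/hasP[i _ /hasP[j _ /mapP[k _ Ek]]].
exists i, j; rewrite !pmulrn quadruple_gap_rmorph.
have uk : ((2 ^ k)%:R : R) != 0.
  by apply: contraTneq (unitrX k u2) => h; rewrite -natrX h unitr0.
case: (quadruple_gap _ _ _) Ek => [g|g] /= Eg; first by rewrite Eg.
by rewrite NegzE mulrNz oppr_eq0 Eg.
Qed.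

(** Every bracket has degree at most 1 in the parameters, and four of them are
multiplied. *)
Lemma size_quadruple_gap (R : idomainType) (x y : {poly R}) ab :
  (size x <= 2)%N -> (size y <= 2)%N -> (size (quadruple_gap x y ab) <= 5)%N.
Proof.
move=> szx szy.
have szbp i :
    (size (branch_point x y 0 i).1 <= 2 /\ size (branch_point x y 0 i).2 <= 1)%N.
  by rewrite /branch_point; case: i => [|[|[|[|[|[|i]]]]]];
    rewrite /= ?nth_nil /= ?size_poly1 ?size_poly0.
pose pt s i := nth (0, 0) [seq branch_point x y 0 i | i <- s] i.
have szpt s i : (size (pt s i).1 <= 2 /\ size (pt s i).2 <= 1)%N.
  rewrite /pt; have [lti|gei] := ltnP i (size s); first by rewrite (nth_map 0%N).
  by rewrite nth_default ?size_map //= size_poly0.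
have szM (p q : {poly R}) k l :
    (size p <= k.+1 -> size q <= l.+1 -> size (p * q)%R <= (k + l).+1)%N.
  move=> szp szq; apply: leq_trans (size_polyMleq _ _) _.
  by rewrite -subn1 leq_subLR (leq_trans (leq_add szp szq)) // addSn addnS.
have szB (p q : {poly R}) k :
    (size p <= k -> size q <= k -> size (p - q)%R <= k)%N.
  move=> szp szq; rewrite (leq_trans (size_polyD _ _)) //.
  by rewrite size_polyN geq_max szp.
rewrite /quadruple_gap /cross_ratio_gap.
have szbr s i j : (size (bracket (pt s i) (pt s j)) <= 2)%N.
  rewrite /bracket; have [i1 i2] := szpt s i; have [j1 j2] := szpt s j.
  by apply: szB; [apply: (szM _ _ 1 0) | apply: (szM _ _ 0 1)].
by apply: szB; apply: (szM _ _ 2 2); apply: (szM _ _ 1 1); apply: szbr.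
Qed.
Section Count.
Variable F : finFieldType.
Hypothesis nz2 : 2 != 0 :> F.

Lemma card_roots_leq (p : {poly F}) k (A : {set F}) :
  p != 0 -> (size p <= k.+1)%N -> {in A, forall x, root p x} -> (#|A| <= k)%N.
Proof.
move=> nzp szp Ap; rewrite cardE -ltnS (leq_trans _ szp) //.
apply: max_poly_roots (enum_uniq _) => //.
by apply/allP => x; rewrite mem_enum => /Ap.
Qed.

(** Take (i, j) where the polynomial does not vanish. At most 4 values x are
zeros on the line y = j; each of them has at most q zeros above it, and each
other x has at most 4. *)
Lemma card_quadruple_gap_zeros ab : ab \in quadruple_pairs ->
  (#|[set xy : F * F | quadruple_gap xy.1 xy.2 ab == 0%R]| <= 8 * #|F|)%N.
Proof.
move=> abq; have u2 : (2 : F) \is a GRing.unit by rewrite unitfE.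
have [i [j nzij]] := quadruple_gap_neq0 u2 abq.
have evx (p q : {poly F}) x :
    (quadruple_gap p q ab).[x] = quadruple_gap p.[x] q.[x] ab.
  exact: (esym (quadruple_gap_rmorph (horner_eval x) p q ab)).
pose X0 := [set x : F | quadruple_gap x j%:R ab == 0].
have cardX0 : (#|X0| <= 4)%N.
  apply: (@card_roots_leq (quadruple_gap 'X (j%:R)%:P ab)).
  - apply: contraNneq nzij => p0.
    by rewrite -[i%:R]hornerX -[j%:R](hornerC _ i%:R) -evx p0 horner0.
  - by rewrite size_quadruple_gap ?size_polyX // ltnW // ltnS size_polyC_leq1.
  - by move=> x; rewrite inE /root evx hornerX hornerC.
have cardY x : x \notin X0 ->
    (#|[set y : F | quadruple_gap x y ab == 0%R]| <= 4)%N.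
  rewrite inE => nzx; apply: (@card_roots_leq (quadruple_gap x%:P 'X ab)).
  - apply: contraNneq nzx => p0.
    by rewrite -[j%:R]hornerX -[x](hornerC _ j%:R) -evx p0 horner0.
  - by rewrite size_quadruple_gap ?size_polyX // ltnW // ltnS size_polyC_leq1.
  - by move=> y; rewrite inE /root evx hornerX hornerC.
have -> : #|[set xy : F * F | quadruple_gap xy.1 xy.2 ab == 0]| =
    (\sum_(x : F) #|[set y : F | quadruple_gap x y ab == 0%R]|)%N.
  under eq_bigr do rewrite -sum1dep_card.
  by rewrite -sum1dep_card pair_big_dep.
rewrite (bigID (mem X0)) /= -[8%N]/(4 + 4)%N mulnDl; apply: leq_add.
  apply: (@leq_trans (\sum_(x in X0) #|F|)).
    by apply: leq_sum => x _; apply: max_card.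
  by rewrite sum_nat_const leq_mul2r cardX0 orbT.
apply: (@leq_trans (\sum_(x | x \notin X0) 4)).
  by apply: leq_sum => x /cardY.
by rewrite sum_nat_const mulnC leq_mul2l max_card orbT.
Qed.

Definition special_pairs : {set F * F} :=
  [set xy | has (fun ab => quadruple_gap xy.1 xy.2 ab == 0) quadruple_pairs].

Lemma card_special_pairs :
  (#|special_pairs| <= size quadruple_pairs * (8 * #|F|))%N.
Proof.
have union s : {subset s <= quadruple_pairs} ->
    (#|[set xy : F * F | has (fun ab => quadruple_gap xy.1 xy.2 ab == 0%R) s]|
       <= size s * (8 * #|F|))%N; last exact: union.
elim: s => [|ab s IHs] sub.
  by rewrite leqn0 cards_eq0; apply/eqP/setP => xy; rewrite !inE.
have {}IHs := IHs (fun c cs => sub c (mem_behead (s := ab :: s) cs)).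
have card_ab := card_quadruple_gap_zeros (sub ab (mem_head _ _)).
rewrite mulSn; apply: leq_trans (leq_add card_ab IHs).
apply: leq_trans (subset_leq_card _) (leq_card_setU _ _).
by apply/subsetP => xy; rewrite !inE.
Qed.

End Count.

Lemma genus2_branch_bracket (K : fieldType) (l m n : K) i j :
    rosenhain_genus2 l m n -> (i < j < 6)%N ->
  bracket (branch_point l m n i) (branch_point l m n j) != 0.
Proof.
move=> gen; case: j => // j /andP[ltij lt5]; rewrite branch_point_affine //.
case: i ltij => [|i] ltij.
  by rewrite /bracket /= mulr1 mul0r subr0 oner_neq0.
have lti5 : (i < 5)%N := ltn_trans ltij lt5.
rewrite branch_point_affine // /bracket /= mulr1 mul1r subr_eq0.
by rewrite nth_uniq // (@ltn_eqF i j ltij).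
Qed.

Lemma genus2_branch_inj (K : fieldType) (l m n : K) i j :
    rosenhain_genus2 l m n -> (i < 6)%N -> (j < 6)%N ->
    bracket (branch_point l m n i) (branch_point l m n j) = 0 -> i = j.
Proof.
move=> gen lti ltj /eqP; have [ij|ij|//] := ltngtP i j.
  by rewrite (negPf (genus2_branch_bracket gen _)) // ij.
by rewrite bracketC oppr_eq0 (negPf (genus2_branch_bracket gen _)) // ij.
Qed.

Lemma branch_point_neq0 (K : fieldType) (l m n : K) i :
  (i < 6)%N -> branch_point l m n i != 0.
Proof.
case: i => [_|i lti]; first by rewrite xpair_eqE oner_eq0.
by rewrite branch_point_affine // xpair_eqE oner_eq0 andbF.
Qed.

Lemma branch_point_common (K : fieldType) (l m n n' : K) i :
  (i < 5)%N -> branch_point l m n i = branch_point l m n' i.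
Proof. by case: i => [|[|[|[|[|]]]]]. Qed.

(** Let p be the permutation induced by the isomorphism. If it fixes three shared
points, M is the identity and the point n of the source is a branch point of
the target, which is impossible. If it swaps two shared points and exchanges
the shared point s with n, then M is an involution, sending s to n' and n to s,
so that n = n'. *)
Lemma isomorphic_neighbour_special (K : closedFieldType) (l m n n' : K) :
    2 != 0 :> K -> n != n' ->
    rosenhain_genus2 l m n -> rosenhain_genus2 l m n' ->
    curve_isomorphic (rosenhain_curve l m n) (rosenhain_curve l m n') ->
  exists2 ab, ab \in quadruple_pairs & quadruple_gap l m ab = 0.
Proof.
move=> nz2 nn' g g' /(isomorphism_bilin nz2 g g')[M det ME].
have [pi piE] := fin_all_exists ME.
pose p i := nat_of_ord (pi (inord i)).
have p6 i : (p i < 6)%N by exact: ltn_ord.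
have pE i : (i < 6)%N ->
    bilin M (branch_point l m n i) (branch_point l m n' (p i)) = 0.
  by move=> lti; have := piE (inord i); rewrite inordK.
have p_inj : {in iota 0 6 &, injective p}.
  move=> i j; rewrite !mem_iota /= !add0n => lti ltj Eij.
  apply: (genus2_branch_inj g lti ltj); apply: (bilin_inj_l det _ (pE i lti)).
    exact: branch_point_neq0.
  by rewrite Eij pE.
pose ps := [seq p i | i <- iota 0 6].
have nthp i : (i < 6)%N -> nth 0%N ps i = p i.
  by move=> lti; rewrite (nth_map 0%N) ?size_iota // nth_iota.
have ps_perm : ps \in permutations (iota 0 6).
  rewrite mem_permutations.
  have ups : uniq ps by rewrite map_inj_in_uniq ?iota_uniq.
  apply: uniq_perm; rewrite ?iota_uniq //.
  apply: (uniq_min_size ups _ _).2; last by rewrite size_map.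
  by move=> _ /mapP[i _ ->]; rewrite mem_iota p6.
clearbody ps.
have mem5 i : i \in iota 0 5 -> (i < 5)%N by rewrite mem_iota.
have lt56 i : (i < 5)%N -> (i < 6)%N by exact: ltnW.
have n_n' : bracket (branch_point l m n 5) (branch_point l m n' 5) != 0.
  by rewrite /bracket /= mulr1 mul1r subr_eq0.
case: (permutation_trichotomy ps_perm) =>
  [/hasP[s s5]|/hasP[i /mem5 i5]|/hasP[s /mem5 s5]].
- move=> abq; exists (omit s, [seq nth 0%N ps i | i <- omit s]) => //.
  have [sz_a /allP lt_b] := quadruple_pairsP abq.
  apply: (bilin_cross_ratio_gap det) => k ltk.
  rewrite !(nth_map 0%N) ?size_map ?sz_a //; set a := nth 0%N (omit s) k.
  have a_s : a \in omit s by rewrite mem_nth ?sz_a.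
  have a5 : (a < 5)%N by move: a_s; rewrite mem_filter => /andP[_ /mem5].
  have b5 : (nth 0%N ps a < 5)%N by apply: lt_b; rewrite map_f.
  rewrite (branch_point_common _ _ 0 n' b5) (branch_point_common _ _ 0 n a5).
  by rewrite branch_point_neq0 ?lt56 // nthp ?pE ?lt56.
- move=> /hasP[j /mem5 j5 /hasP[k /mem5 k5 /and5P[ij jk]]].
  rewrite !nthp ?lt56 // => /eqP pi_i /eqP pj /eqP pk.
  have fix_ a : (a < 5)%N -> p a = a ->
      bilin M (branch_point l m n a) (branch_point l m n a) = 0.
    move=> a5 pa.
    by rewrite -[RHS](pE a (lt56 a a5)) pa (branch_point_common _ _ n n').
  have fixed := bilin_fix3 det _ _ _ _
    (fix_ _ i5 pi_i) (fix_ _ j5 pj) (fix_ _ k5 pk).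
  have : bracket (branch_point l m n 5) (branch_point l m n' (p 5)) = 0.
    apply: fixed; rewrite ?branch_point_neq0 ?genus2_branch_bracket ?pE //.
    - by rewrite ij lt56.
    - by rewrite (ltn_trans ij jk) lt56.
    - by rewrite jk lt56.
  have [->|p5] : p 5 = 5%N \/ (p 5 < 5)%N.
    by move: (p6 5%N); rewrite ltnS leq_eqVlt => /orP[/eqP|]; [left|right].
  + by move/eqP; rewrite (negPf n_n').
  + rewrite (branch_point_common _ _ n' n) //.
    by move/(@genus2_branch_inj _ _ _ _ 5 _ g isT (p6 _)) => E; rewrite -E in p5.
- case/and3P; rewrite (nthp _ (lt56 _ s5)) (nthp 5%N) // => /eqP ps5 /eqP p5.
  case/hasP=> i /mem5 i5 /and3P[].
  rewrite (nthp _ (lt56 _ i5)) (nthp _ (p6 _)) => pi5 pii /eqP ppi.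
  have sym : forall x y, bilin M x y = bilin M y x.
    apply: (@bilin_swap _ M (branch_point l m n i) (branch_point l m n (p i))).
    - apply/eqP => /(genus2_branch_inj g (lt56 _ i5) (p6 _)) E.
      by rewrite -E eqxx in pii.
    - by rewrite (branch_point_common _ _ n n' pi5) pE // lt56.
    - rewrite (branch_point_common _ _ n n' i5).
      by rewrite -[X in branch_point l m n' X]ppi pE // lt56.
  case/eqP: n_n'.
  apply: (@bilin_inj_r _ M det (branch_point l m n s)).
  + exact/branch_point_neq0/lt56.
  + by rewrite sym (branch_point_common _ _ n n' s5) -p5 pE.
  + by rewrite -ps5 pE // lt56.
Qed.

Lemma card_not01 (F : finFieldType) : #|not01 F| = (#|F| - 2)%N.
Proof. by rewrite -(cardsC [set 0; 1 : F]) cards2 eq_sym oner_eq0 addKn. Qed.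

(** The condition is polynomial in the parameters, so it descends from K to F. *)
Lemma neighbour_triples_special (F : finFieldType) (K : closedFieldType)
    (iota : {rmorphism F -> K}) t :
    2 != 0 :> F -> has_isomorphic_neighbour iota t -> t.1 \in special_pairs F.
Proof.
case: t => [[l1 l2] l3] nz2 [l3' [l33' g g' iso]].
have gi x : rosenhain_genus2 l1 l2 x ->
    rosenhain_genus2 (iota l1) (iota l2) (iota x).
  rewrite /rosenhain_genus2 -(map_inj_uniq (fmorph_inj iota)) /=.
  by rewrite rmorph0 rmorph1.
have nz2K : 2 != 0 :> K by rewrite -(rmorph_nat iota) fmorph_eq0.
have nn' : iota l3 != iota l3' by rewrite (inj_eq (fmorph_inj iota)).
have [ab abq] :=
  isomorphic_neighbour_special nz2K nn' (gi _ g) (gi _ g') iso.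
rewrite quadruple_gap_rmorph => /eqP; rewrite fmorph_eq0 => gap0.
by rewrite inE; apply/hasP; exists ab.
Qed.

(** The constant 64 is 8 for the zeros of each polynomial times 8 from
q <= 2 (q - 2), cubed. *)
Lemma ratio_cube_bound (N s q : nat) :
    (4 <= q)%N -> (N <= s * (8 * q) * q)%N ->
  (N%:R / ((q - 2) ^ 3)%:R : rat) <= (64 * s)%:R / q%:R.
Proof.
move=> q_ge4 leN; have q2_gt0 : (0 < q - 2)%N by rewrite subn_gt0 (leq_trans _ q_ge4).
rewrite ler_pdivrMr ?ltr0n ?expn_gt0 ?q2_gt0 // mulrAC ler_pdivlMr; last first.
  by rewrite ltr0n (leq_trans _ q_ge4).
rewrite -!natrM ler_nat; apply: leq_trans (leq_mul leN (leqnn _)) _.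
have q_le : (q <= 2 * (q - 2))%N by lia.
have := leq_mul (leq_mul q_le q_le) q_le; set r := (q - 2)%N => qr.
rewrite (_ : _ * _ * q = 8 * s * (q * q * q))%N; last by lia.
rewrite (_ : 64 * _ * r ^ 3 = 8 * s * (2 * r * (2 * r) * (2 * r)))%N.
  by rewrite leq_mul2l qr orbT.
by rewrite !expnS expn0; lia.
Qed.

Theorem proposition3p1p5 :
  exists c : rat,
    forall (p : nat) (F : finFieldType) (K : closedFieldType)
           (iota : {rmorphism F -> K}),
      prime p -> (7 <= p)%N -> #|F| = (p ^ 2)%N -> integralRange iota ->
      uniform_prob (not01_triples F) (has_isomorphic_neighbour iota)
        <= c / p%:R ^+ 2.
Proof.
exists (64 * size quadruple_pairs)%:R => p F K iota pr_p p_ge7 cardF _.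
have nz2 : 2 != 0 :> F.
  rewrite -(dvdn_pcharf (card_finPcharP cardF pr_p)).
  by rewrite gtnNdvd // (leq_trans _ p_ge7).
have q_ge4 : (4 <= #|F|)%N by rewrite cardF (@leq_exp2r 2 p 2) // (leq_trans _ p_ge7).
rewrite /uniform_prob -natrX -cardF; set E := [set t in _ | _].
have cardE : (#|E| <= size quadruple_pairs * (8 * #|F|) * #|F|)%N.
  apply: (@leq_trans #|setX (special_pairs F) [set: F]|).
    apply/subset_leq_card/subsetP => -[xy z]; rewrite inE => /andP[_ /boolp.asboolP ht].
    by rewrite in_setX in_setT andbT; exact: neighbour_triples_special nz2 ht.
  by rewrite cardsX cardsT leq_mul2r card_special_pairs ?orbT.
have card_triples : #|not01_triples F| = ((#|F| - 2) ^ 3)%N.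
  by rewrite /not01_triples !cardsX card_not01 !expnS expn0 muln1 mulnA.
by rewrite card_triples; apply: ratio_cube_bound.
Qed.
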